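(* Let $N\ge3$, let $\mathcal{L}$ be a singular Born--Infeld type Lagrangian with truncation threshold $s\le\frac12$ (i.e. $|\nabla\phi|^2\le1$ for $s=\frac12|\nabla\phi|^2$), $b=\mathcal{L}'$, and let $\rho\in\mathcal{A}^*$. Assume that $\phi_0\in\mathcal{A}$ is the minimizer of $I(\phi)=\int_{\mathbb{R}^N}\mathcal{L}\left(\frac12|\nabla\phi|^2\right)dx-\langle\rho,\phi\rangle$ over $\mathcal{A}$. Then: 1. There exists a monotone decreasing positive sequence $\{\delta_n\}_{n\ge1}$ with $\lim_{n\to\infty}\delta_n=0$ such that the sets $G^c(\delta_n)=\{x\in\mathbb{R}^N: 1\ge|\nabla\phi_0|^2\ge1-\delta_n\}$ satisfy $\lim_{n\to\infty}G^c(\delta_n)=G^c(0):=\{x\in\mathbb{R}^N: |\nabla\phi_0|^2=1\}$, and $G^c(0)$ is a Lebesgue null set. 2. $b\left(\frac12|\nabla\phi_0|^2\right)|\nabla\phi_0|^2\in L^1(\mathbb{R}^N)$. 3. For every $\psi\in\mathcal{A}$, $$\langle\rho,\phi_0-\psi\rangle\ge\int_{\mathbb{R}^N}b\left(\tfrac12|\nabla\phi_0|^2\right)\nabla\phi_0\cdot(\nabla\phi_0-\nabla\psi)\,dx.$$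
   Context: Function space: $\mathcal{A}=D^{1,2}(\mathbb{R}^N)\cap\{\phi\in C^{0,1}(\mathbb{R}^N): |\nabla\phi|^2\le 1 \text{ a.e.}\}$, with $\|\phi\|_{D^{1,2}}=\left(\int_{\mathbb{R}^N}|\nabla\phi|^2dx\right)^{1/2}$. $\mathcal{A}^*$ denotes its dual, i.e. the linear functionals $\rho$ satisfying $|\langle\rho,\phi\rangle|\le \|\rho\|_{\mathcal{A}^*}\|\nabla\phi\|_{L^2}$. Singular Born--Infeld type Lagrangian with truncation threshold $s\le\frac12$: a $C^2$ function $\mathcal{L}:[0,\frac12)\to\mathbb{R}$ with $\mathcal{L}(0)=0$, $\mathcal{L}'(0)=1$, $b(s):=\mathcal{L}'(s)>0$ and $\mathcal{L}''(s)>0$ for all $s$, $\lim_{s\to(1/2)^-}\mathcal{L}(s)=+\infty$ and $\lim_{s\to(1/2)^-}b(s)=+\infty$. One sets $\mathcal{L}(\frac12)=+\infty$, so $I$ takes values in $(-\infty,+\infty]$. The limit of the decreasing sets $G^c(\delta_n)$ is their intersection. *)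

(* Defs.v *)
From HB Require Import structures.
From mathcomp Require Import all_boot all_order all_algebra.
From mathcomp Require Import all_classical all_reals all_analysis.
From mathcomp Require Import measurable_realfun.
From mathcomp Require Import lra.
Set Implicit Arguments.
Unset Strict Implicit.
Unset Printing Implicit Defensive.
Import Order.TTheory GRing.Theory Num.Theory.
Import numFieldNormedType.Exports.
Local Open Scope classical_set_scope.
Local Open Scope ring_scope.

(* ['rV[R]_n] carries the Borel sigma-algebra of its norm topology. *)
HB.instance Definition _ (R : realType) (n : nat) :=
  @isMeasurable.Build (sigma_display (@open 'rV[R]_n)) 'rV[R]_n
    <<s (@open 'rV[R]_n) >> (@sigma_algebra0 _ setT _)
    (@sigma_algebraC _ _) (@sigma_algebra_bigcup _ setT _).

Section lebesgue_rV.
Variable R : realType.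

Definition rV_cons n (p : measurableTypeR R * 'rV[R]_n) : 'rV[R]_n.+1 :=
  row_mx (p.1 : R)%:M p.2.

Lemma rV_cons0 n (p : measurableTypeR R * 'rV[R]_n) : rV_cons p ord0 ord0 = p.1.
Proof.
rewrite /rV_cons mxE; case: splitP => //= j _.
by rewrite mxE (ord1 j) eqxx mulr1n.
Qed.

Lemma rV_consS n (p : measurableTypeR R * 'rV[R]_n) (i : 'I_n) :
  rV_cons p ord0 (lift ord0 i) = p.2 ord0 i.
Proof.
rewrite /rV_cons mxE; case: splitP => [k /=|k /= /eqP]; first by rewrite (ord1 k).
by rewrite /bump/= eqSS => /eqP ik; rewrite (val_inj ik : i = k).
Qed.

Lemma rV_ball_rat n (x : 'rV[R]_n) (e : R) : 0 < e ->
  exists q : 'rV[rat]_n, ball x e (map_mx ratr q).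
Proof.
move=> e0.
have H (i : 'I_n) : exists q : rat, `|x ord0 i - ratr q| < e.
  have : x ord0 i - e < x ord0 i + e by lra.
  move=> /rat_in_itvoo [q /itvP qP]; exists q.
  by rewrite distrC ltr_distl !qP.
have /choice[q qP] := H.
exists (\row_i q i); split => // i j.
by rewrite ord1 /ball/= !mxE; exact: qP.
Qed.

Lemma rV_open_bigcup n (U : set 'rV[R]_n) : open U ->
  exists F : nat -> set 'rV[R]_n,
    U = \bigcup_k F k /\
    forall k, F k = set0 \/ exists (c : 'rV[R]_n) (e : R), 0 < e /\ F k = ball c e.
Proof.
move=> oU.
pose B (p : 'rV[rat]_n * nat) : set 'rV[R]_n :=
  ball (map_mx ratr p.1 : 'rV[R]_n) (p.2.+1%:R^-1 : R).
pose F k := if unpickle k is Some p then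
   if pselect (B p `<=` U) then B p else set0 else set0.
exists F; split; last first.
  move=> k; rewrite /F; case: unpickle => [p|]; last by left.
  case: pselect => /= [_|_]; last by left.
  by right; exists (map_mx ratr p.1), p.2.+1%:R^-1; split.
apply/seteqP; split => [x Ux|x [k _]]; last first.
  rewrite /F; case: unpickle => [p|//].
  by case: pselect => //= pU; exact: pU.
have /nbhs_ballP[e /= e0 eU] : nbhs x U by apply: open_nbhs_nbhs.
have e20 : 0 < e / 2 by rewrite divr_gt0.
have [m me] : exists m : nat, m.+1%:R^-1 < e / 2.
  have [m _ /(_ _ (leqnn m))] := near_infty_natSinv_lt (PosNum e20).
  by exists m.
have m0 : 0 < m.+1%:R^-1 :> R by rewrite invr_gt0 ltr0n.
have [q qx] := rV_ball_rat x m0.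
exists (pickle (q, m)) => //.
rewrite /F pickleK; case: pselect => /= [_|[]]; first exact: ball_sym.
move=> y yB; apply: eU.
rewrite (splitr e); apply: (@ball_triangle _ _ (map_mx ratr q : 'rV[R]_n)).
  by apply: le_ball qx; exact/ltW.
by apply: le_ball yB; exact/ltW.
Qed.

Lemma measurable_rV_cons n : measurable_fun setT (@rV_cons n).
Proof.
apply: (@measurability _ _ _ _ setT _ (@open 'rV[R]_n.+1)) => //.
move=> _ [U oU <-]; rewrite setTI.
have [F [-> FB]] := rV_open_bigcup oU.
rewrite preimage_bigcup; apply: bigcup_measurable => k _.
have [->|[c [e [e0 ->]]]] := FB k; first by rewrite preimage_set0.
have -> : @rV_cons n @^-1` ball c e =
   (ball (c ord0 ord0) e : set R) `*`
   ball (\row_(i < n) c ord0 (lift ord0 i) : 'rV[R]_n) e.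
  apply/seteqP; split => -[a v] /=.
    case=> _ H; split.
      by have := H ord0 ord0; rewrite rV_cons0.
    split=> // i j; have := H i (lift ord0 j).
    by rewrite !ord1 rV_consS !mxE.
  move=> [H1 [_ H2]]; split=> // i j; rewrite ord1.
  have [->|j0] := eqVneq j ord0; first by rewrite rV_cons0.
  have [k0 ->] : exists k0, j = lift ord0 k0.
    by case: (unliftP ord0 j) j0 => [k0 ->|->]; [exists k0|rewrite eqxx].
  by rewrite rV_consS; have := H2 ord0 k0; rewrite mxE.
apply: measurableX.
  by apply: open_measurable; exact: ball_open.
by apply: sub_sigma_algebra; exact: ball_open.
Qed.

Definition rV_leb_step n (mu : {sigma_finite_measure set 'rV[R]_n -> \bar R}) :
  set 'rV[R]_n.+1 -> \bar R :=
  pushforward (lebesgue_measure \x mu)%E (@rV_cons n).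

Section rV_leb_step_measure.
Variables (n : nat) (mu : {sigma_finite_measure set 'rV[R]_n -> \bar R}).
Local Open Scope ereal_scope.

Let step0 : rV_leb_step mu set0 = 0.
Proof. by rewrite /rV_leb_step /pushforward preimage_set0 measure0. Qed.

Let step_ge0 A : 0 <= rV_leb_step mu A.
Proof. by rewrite /rV_leb_step /pushforward; exact: measure_ge0. Qed.

Let mpre A : measurable A -> measurable (@rV_cons n @^-1` A).
Proof. by move=> mA; rewrite -[X in measurable X]setTI; exact: measurable_rV_cons. Qed.

Let step_sigma_additive : semi_sigma_additive (rV_leb_step mu).
Proof.
move=> F mF tF mUF; rewrite /rV_leb_step /pushforward preimage_bigcup.
apply: measure_semi_sigma_additive.
- by move=> n0; exact: mpre.
- apply/trivIsetP => /= i j _ _ ij; rewrite -preimage_setI.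
  by move/trivIsetP : tF => /(_ _ _ _ _ ij) ->//; rewrite preimage_set0.
- by rewrite -preimage_bigcup; exact: mpre.
Qed.

HB.instance Definition _ := isMeasure.Build _ _ _ (rV_leb_step mu)
  step0 step_ge0 step_sigma_additive.

Let step_sigma_finite : sigma_finite setT (rV_leb_step mu).
Proof.
pose uncons (v : 'rV[R]_n.+1) : measurableTypeR R * 'rV[R]_n :=
  (v ord0 ord0, \row_i v ord0 (lift ord0 i)).
have consK : cancel (@rV_cons n) uncons.
  move=> [a v]; rewrite /uncons rV_cons0; congr pair.
  by apply/rowP => i; rewrite mxE rV_consS.
have munc : measurable_fun setT uncons.
  apply: measurable_fun_pair.
    apply: (measurability _ (RGenOpens.measurableE R)) => //.
    move=> _ [_ [a [b ->] <-]]; rewrite setTI; apply: sub_sigma_algebra.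
    apply: open_comp; last exact: interval_open.
    by move=> x _; exact: coord_continuous.
  apply: (@measurability _ _ _ _ setT _ (@open 'rV[R]_n)) => //.
  move=> _ [U oU <-]; rewrite setTI; apply: sub_sigma_algebra.
  apply: open_comp oU => x _ A /nbhs_ballP[e e0 eA].
  apply/nbhs_ballP; exists e => //= y [_ xy]; apply: eA.
  by split=> // i j; rewrite !mxE; exact: xy.
have /sigma_finiteP[F [TF ndF Foo]] := sigma_finiteT (@lebesgue_measure R).
have /sigma_finiteP[G [TG ndG Goo]] := sigma_finiteT mu.
exists (fun k => uncons @^-1` (F k `*` G k)).
  rewrite -preimage_bigcup -[LHS](preimage_setT uncons); congr preimage.
  rewrite -setXTT TF TG predeqE => -[x y]; split.
    move=> [/= [i _ Fix] [k _ Gky]]; exists (maxn i k) => //; split.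
    - by move: x Fix; exact/subsetPset/ndF/leq_maxl.
    - by move: y Gky; exact/subsetPset/ndG/leq_maxr.
  by move=> [i _ []/= ? ?]; split; exists i.
move=> k; have [mF Fk] := Foo k; have [mG Gk] := Goo k; split.
  by rewrite -[X in measurable X]setTI; apply: munc => //; exact: measurableX.
rewrite /rV_leb_step /pushforward -comp_preimage.
rewrite (_ : uncons \o _ = id) ?preimage_id; last first.
  by apply/funext => x; rewrite /= consK.
by rewrite product_measure1E// lte_mul_pinfty// ge0_fin_numE.
Qed.

HB.instance Definition _ := Measure_isSigmaFinite.Build _ _ _ (rV_leb_step mu)
  step_sigma_finite.
End rV_leb_step_measure.

(* Lebesgue measure on R^n, as the n-fold product of [lebesgue_measure]. *)
Fixpoint rV_leb n : {sigma_finite_measure set 'rV[R]_n -> \bar R} :=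
  match n return {sigma_finite_measure set 'rV[R]_n -> \bar R} with
  | 0 => dirac (0 : 'rV[R]_0)
  | m.+1 => rV_leb_step (rV_leb m)
  end.
End lebesgue_rV.

Section test_functions.
Variables (R : realType) (N : nat).
Implicit Types u : 'rV[R]_N -> R.

Definition dotv (v w : 'rV[R]_N) : R := \sum_(i < N) v ord0 i * w ord0 i.

(* The square of the Euclidean norm (the library's norm on ['rV[R]_N] is the
   sup norm). *)
Definition sqnorm (v : 'rV[R]_N) : R := dotv v v.

Definition pderiv (i : 'I_N) u : 'rV[R]_N -> R :=
  fun x => 'D_(delta_mx ord0 i) u x.

Definition iter_pderiv (s : seq 'I_N) u : 'rV[R]_N -> R := foldr pderiv u s.

(* C_c^infty(R^N): all iterated partial derivatives exist and are continuous,
   and the support is compact. *)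
Definition test_function u :=
  [/\ forall (s : seq 'I_N) (i : 'I_N) x,
        derivable (iter_pderiv s u) x (delta_mx ord0 i),
      forall s : seq 'I_N, continuous (iter_pderiv s u) &
      compact (closure [set x | u x != 0])].

Definition classical_gradient u (x : 'rV[R]_N) : 'rV[R]_N :=
  \row_i pderiv i u x.

End test_functions.

Section function_space.
Variables (R : realType) (N : nat).
Local Notation E := 'rV[R]_N.
Local Notation leb := (@rV_leb R N).
Implicit Types (u v : E -> R) (g : E -> E).

(* The critical Sobolev exponent 2* = 2N/(N-2), meaningful for N >= 3. *)
Definition sobolev_exponent : R := (2 * N)%:R / (N - 2)%:R.

(* D^{1,2}(R^N) is the completion of C_c^infty(R^N) for the norm |grad u|_{L^2}.
   For N >= 3 the Sobolev inequality realizes the completion inside L^{2*}: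
   its elements are the L^{2*}-limits u of sequences of test functions whose
   gradients converge in L^2, and the limit g of these gradients, unique up to
   a null set, is the (weak) gradient of u. *)
Definition D12_gradient u g :=
  [/\ measurable_fun setT u, measurable_fun setT g &
      exists u_ : nat -> E -> R,
        [/\ forall n, test_function (u_ n),
            (fun n => 'N[leb]_(sobolev_exponent%:E)
                        [EFin \o (u_ n \- u)%R])%E @ \oo --> 0%E &
            (fun n => \int[leb]_x
                        (sqnorm (classical_gradient (u_ n) x - g x))%:E)%E
              @ \oo --> 0%E]].

Definition D12 : set (E -> R) := [set u | exists g, D12_gradient u g].

(* A representative of the almost everywhere defined gradient of u in D^{1,2}
   (for Lipschitz u it agrees a.e. with the classical gradient). *)
Definition grad u : E -> E := xget (fun=> 0) [set g | D12_gradient u g].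

Definition D12_norm u : R := Num.sqrt (\int[leb]_x sqnorm (grad u x)).

Definition spaceA : set (E -> R) :=
  [set u | [/\ D12 u, lipschitz u & {ae leb, forall x, sqnorm (grad u x) <= 1}]].

(* The linear span of [spaceA]; multiples suffice as [spaceA] is convex and
   symmetric. *)
Definition spanA : set (E -> R) :=
  [set u | exists (a : R) v, spaceA v /\ u = a *: v].

(* [rho] is only meaningful on [spanA]. *)
Definition dualA (rho : (E -> R) -> R) :=
  (forall (a : R) u v, spanA u -> spanA v ->
     rho (a *: u + v) = a * rho u + rho v) /\
  exists C : R, forall u, spaceA u -> `|rho u| <= C * D12_norm u.

End function_space.

Section lagrangian.
Variable R : realType.
Implicit Types f L : R -> R.

Definition lagr_dom : set R := [set s | 0 <= s < 2^-1].

(* Derivatives of functions on [0, 1/2), one-sided at 0. *)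
Definition dom_quotient f (s t : R) : R := (f t - f s) / (t - s).
Definition dom_derivable f (s : R) : Prop :=
  cvg (dom_quotient f s t @[t --> within lagr_dom s^']).
Definition dom_derive f (s : R) : R :=
  lim (dom_quotient f s t @[t --> within lagr_dom s^']).

(* Only the values of L on [0, 1/2) matter. *)
Record born_infeld L : Prop := BornInfeld {
  bi_derivable : forall s, lagr_dom s -> dom_derivable L s;
  bi_derivable2 : forall s, lagr_dom s -> dom_derivable (dom_derive L) s;
  bi_C2 : {within lagr_dom, continuous (dom_derive (dom_derive L))};
  bi_L0 : L 0 = 0;
  bi_b0 : dom_derive L 0 = 1;
  bi_b_gt0 : forall s, lagr_dom s -> 0 < dom_derive L s;
  bi_L2_gt0 : forall s, lagr_dom s -> 0 < dom_derive (dom_derive L) s;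
  bi_L_sing : (L s)%:E @[s --> 2^-1^'-] --> +oo%E;
  bi_b_sing : (dom_derive L s)%:E @[s --> 2^-1^'-] --> +oo%E
}.

(* L and b = L' with their limit value +oo at 1/2; the values beyond 1/2 are
   never used outside a null set. *)
Definition lagr L (s : R) : \bar R := if s < 2^-1 then (L s)%:E else +oo%E.
Definition lagr_b L (s : R) : \bar R :=
  if s < 2^-1 then (dom_derive L s)%:E else +oo%E.

End lagrangian.

Section functional.
Variables (R : realType) (N : nat) (L : R -> R) (rho : ('rV[R]_N -> R) -> R).
Implicit Types u : 'rV[R]_N -> R.
Local Notation leb := (@rV_leb R N).

Definition bi_energy u : \bar R :=
  (\int[leb]_x lagr L (2^-1 * sqnorm (grad u x)) - (rho u)%:E)%E.

Definition minimizer u :=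
  spaceA u /\ forall v, spaceA v -> (bi_energy u <= bi_energy v)%E.

End functional.

Section level_sets.
Variables (R : realType) (N : nat) (u : 'rV[R]_N -> R).

Definition Gc (delta : R) : set 'rV[R]_N :=
  [set x | 1 - delta <= sqnorm (grad u x) <= 1].
Definition Gc0 : set 'rV[R]_N := [set x | sqnorm (grad u x) = 1].

End level_sets.

(* Main.v *)
From HB Require Import structures.
Require Import Defs.
From mathcomp Require Import all_boot all_order all_algebra.
From mathcomp Require Import all_classical all_reals all_analysis.
From mathcomp Require Import measurable_realfun.
From mathcomp Require Import ring lra.
Set Implicit Arguments.
Unset Strict Implicit.
Unset Printing Implicit Defensive.
Import Order.TTheory GRing.Theory Num.Theory.
Import numFieldNormedType.Exports.
Local Open Scope classical_set_scope.
Local Open Scope ring_scope.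

(** Compare [phi0] with [v_t = (1 - t) phi0 + t w], where [w = l psi] and
[0 <= l < 1], so that [|grad w| <= l] and [w] has finite energy.  Since the
Lagrangian is convex, the difference quotients of its value at [grad phi0] and
at [grad v_t] are bounded below by the integrable difference of its values at
[grad phi0] and [grad w], and their integrals are at most [<rho, phi0 - w>] by
minimality.  Fatou's lemma as [t] tends to 0 gives both the integrability of
[b grad phi0 . (grad phi0 - l grad psi)] and the bound of its integral by
[<rho, phi0 - l psi>]; [l = 0] is the second claim, and as everything is affine
in [l], letting [l] tend to 1 gives the third.  The first claim holds because
[phi0] has finite energy while the Lagrangian is infinite where
[|grad phi0| = 1].

That [grad v_t] is a.e. the combination of [grad phi0] and [grad w] requires
the closability of the gradient: if test functions tend to 0 in L^{2*} and
their gradients tend to [h] in L^2, integration by parts against C^1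
approximations of the indicator of a box shows that [h] integrates to 0 over
every box, so [h = 0] a.e. *)

(** * One-sided calculus and the Lagrangian *)

(** The competitors lie on a segment because the constraint on the gradient only allows convex
    directions; this is why an inequality results and not an Euler-Lagrange equation. The factor [l]
    is needed because [psi] may have gradient of length 1 on a set of positive measure: its energy
    is then infinite and the lower bound for Fatou is lost. Pointwise, only the squared lengths of
    the two gradients and their scalar product matter, half the squared length of the gradient of
    [v_t] being a quadratic polynomial in [t]. The limit is therefore taken for three scalar
    functions on an arbitrary measure space, and gradients enter only afterwards. A gradient is a
    chosen representative of an L^2 limit, so even its linearity holds only a.e. and only once the
    gradient of the zero function is known to vanish: a priori, test functions could tend to 0 while
    their gradients tend to something else. In the integration by parts that excludes this, a single
    derivative falls on the cut-off, so C^1 cut-offs given by an explicit formula are enough. The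
    bound [3 <= N] makes the exponent 2* larger than 1, as Minkowski and Hoelder require. *)

Section dom_derive.
Context {R : realType}.
Implicit Types (f : R -> R) (s t : R).

Lemma near_lagr_dom s : 0 < s < 2^-1 -> \forall t \near s, lagr_dom t.
Proof.
move=> /andP[s0 s1]; near=> t; apply/andP; split.
  by near: t; exact: lt_le_nbhsr.
by near: t; exact: lt_nbhsl.
Unshelve. all: by end_near. Qed.

(** At an interior point all nearby [t] belong to [lagr_dom], so the restricted limit is the
    ordinary one. This gives access to the mean value theorem. *)
Lemma dom_derivable_is_derive f s : 0 < s < 2^-1 -> dom_derivable f s ->
  is_derive s 1 f (dom_derive f s).
Proof.
move=> s01 df.
have lim_f : h^-1 *: (f (h *: 1 + s) - f s) @[h --> 0^'] --> dom_derive f s.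
  have shift : (h + s) @[h --> 0^'] --> within (@lagr_dom R) s^'.
    move=> P /= sP.
    have nP : \forall t \near s, t != s -> P t.
      have sP' : \forall t \near s, t != s -> lagr_dom t -> P t by exact: sP.
      near=> t => ts; apply: (near sP' t) => //.
      by near: t; exact: near_lagr_dom.
    have cs : (h + s) @[h --> (0:R)] --> s.
      rewrite -[X in _ --> X]add0r; apply: cvgD; [exact: cvg_id|exact: cvg_cst].
    have nP' : \forall h \near 0, h + s != s -> P (h + s) by exact: (cs _ nP).
    have : \forall h \near 0^', P (h + s); last exact.
    have nP2 := nbhs_dnbhs nP'.
    near=> h; apply: (near nP2 h) => //.
    by rewrite -subr_eq0 addrK; near: h; exact: nbhs_dnbhs_neq.
  have := cvg_comp _ _ shift df.
  apply: cvg_trans; apply: near_eq_cvg; near=> h => /=.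
  by rewrite /dom_quotient addrK /= mulrC [h *: 1]mulr1.
split; first by apply/cvg_ex; exists (dom_derive f s).
exact: cvg_lim lim_f.
Unshelve. all: by end_near. Qed.

Lemma dom_derivable_continuous f :
  (forall s, lagr_dom s -> dom_derivable f s) ->
  {within @lagr_dom R, continuous f}.
Proof.
move=> df; apply/subspace_continuousP => s sd.
(* Near [s] the quotient is within 1 of its limit [l], so [f] varies by at most [(]|l| + 1) *
   [|t - s|]. This argument also covers the endpoint 0. *)
have := df _ sd; rewrite /dom_derivable => /cvg_ex[l /cvgrPdist_lt/(_ 1 ltr01) fl].
apply/cvgrPdist_le => e e0.
have c0 : 0 < `|l| + 1 by rewrite ltr_wpDl.
rewrite near_withinE /=.
move: fl; rewrite !near_withinE => fl.
near=> t => td.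
have [->|ts] := eqVneq t s; first by rewrite subrr normr0 ltW.
have ql : `|l - dom_quotient f s t| < 1 by apply: (near fl t).
have q1 : `|dom_quotient f s t| <= `|l| + 1.
  have := ler_normB l (l - dom_quotient f s t).
  by rewrite opprB addrCA subrr addr0; lra.
have -> : f s - f t = - dom_quotient f s t * (t - s).
  by rewrite /dom_quotient mulNr divfK ?subr_eq0// opprB.
rewrite normrM normrN.
apply: (@le_trans _ _ ((`|l| + 1) * `|t - s|)); first exact: ler_wpM2r.
rewrite mulrC -ler_pdivlMr// distrC ltW//.
near: t; apply: nbhsx_ballx; exact: divr_gt0.
Unshelve. all: by end_near. Qed.

Lemma convex_lagr_dom s t (l : R) : lagr_dom s -> lagr_dom t -> 0 <= l <= 1 ->
  lagr_dom ((1 - l) * s + l * t).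
Proof.
move=> /andP[s0 s1] /andP[t0 t1] /andP[l0 l1].
rewrite /lagr_dom /= addr_ge0 ?mulr_ge0 ?subr_ge0//=.
by have [st|ts] := leP s t; [apply: le_lt_trans t1|apply: le_lt_trans s1]; nra.
Qed.

Lemma lagr_dom_itv : @lagr_dom R = `[0, 2^-1[%classic.
Proof. by apply/seteqP; split=> x /=; rewrite in_itv. Qed.

(** The value [s = 0] is allowed: the mean value theorem wants derivatives only strictly inside the
    interval, and continuity at 0 follows from the one-sided derivative. *)
Lemma lagr_dom_mvt f s t :
  (forall s, lagr_dom s -> dom_derivable f s) ->
  0 <= s -> s < t -> t < 2^-1 ->
  exists2 c, s < c < t & f t - f s = dom_derive f c * (t - s).
Proof.
move=> df s0 st t1.
have sub : `[s, t]%classic `<=` @lagr_dom R.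
  move=> x /=; rewrite in_itv /= => /andP[sx xt].
  by apply/andP; split; [exact: le_trans sx|exact: le_lt_trans t1].
have [||c cst ->] := MVT (f := f) (df := dom_derive f) st.
- move=> x; rewrite in_itv /= => /andP[sx xt].
  apply: dom_derivable_is_derive.
    by rewrite (le_lt_trans s0 sx) (lt_trans xt t1).
  by apply/df/andP; split; [exact/ltW/(le_lt_trans s0)|exact: lt_trans t1].
- by apply: continuous_subspaceW sub _; exact: dom_derivable_continuous.
by exists c => //; move: cst; rewrite in_itv.
Qed.

End dom_derive.

Section born_infeld_theory.
Context {R : realType} (L : R -> R).
Hypothesis LBI : born_infeld L.
Local Notation b := (dom_derive L).
Implicit Types s t : R.

Lemma bi_b_continuous : {within @lagr_dom R, continuous b}.
Proof. exact/dom_derivable_continuous/(bi_derivable2 LBI). Qed.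

Lemma bi_b_nondecreasing s t : 0 <= s -> s <= t -> t < 2^-1 -> b s <= b t.
Proof.
move=> s0; rewrite le_eqVlt => /predU1P[->//|st] t1.
have [c /andP[sc ct] E] := lagr_dom_mvt (bi_derivable2 LBI) s0 st t1.
rewrite -subr_ge0 E mulr_ge0 ?subr_ge0 ?(ltW st)// ltW// (bi_L2_gt0 LBI)//.
by apply/andP; split; [exact/ltW/(le_lt_trans s0)|exact: lt_trans t1].
Qed.

Lemma bi_b_ge0 s : 0 <= s -> s < 2^-1 -> 0 <= b s.
Proof. by move=> s0 s1; rewrite ltW// (bi_b_gt0 LBI)//; apply/andP. Qed.

Lemma bi_nondecreasing s t : 0 <= s -> s <= t -> t < 2^-1 -> L s <= L t.
Proof.
move=> s0; rewrite le_eqVlt => /predU1P[->//|st] t1.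
have [c /andP[sc ct] E] := lagr_dom_mvt (bi_derivable LBI) s0 st t1.
rewrite -subr_ge0 E mulr_ge0 ?subr_ge0 ?(ltW st)// bi_b_ge0//.
  exact/ltW/(le_lt_trans s0).
exact: lt_trans t1.
Qed.

Lemma bi_ge0 s : 0 <= s -> s < 2^-1 -> 0 <= L s.
Proof. by move=> s0 s1; rewrite -(bi_L0 LBI) bi_nondecreasing. Qed.

(** The increment of [L] is [b c * (t - s)] for an intermediate [c], and monotonicity of [b]
    compares [b c] with [b s] in the right direction on either side of [s]. *)
Lemma bi_tangent s t : 0 <= s < 2^-1 -> 0 <= t < 2^-1 ->
  b s * (t - s) <= L t - L s.
Proof.
move=> /andP[s0 s1] /andP[t0 t1]; have [st|ts|->] := ltgtP s t; last by rewrite !subrr mulr0.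
- have [c /andP[sc ct] ->] := lagr_dom_mvt (bi_derivable LBI) s0 st t1.
  by rewrite ler_wpM2r ?subr_ge0 ?(ltW st)// bi_b_nondecreasing ?(ltW sc)// (lt_trans ct).
- have [c /andP[sc ct] E] := lagr_dom_mvt (bi_derivable LBI) t0 ts s1.
  rewrite -lerN2 opprB E -mulrN opprB.
  rewrite ler_wpM2r ?subr_ge0 ?(ltW ts)// bi_b_nondecreasing ?(ltW ct)//.
  exact/ltW/(le_lt_trans t0).
Qed.

(** Average the tangent inequalities at the intermediate point [m] towards [s] and [t]: the slope
    terms cancel because [m] is the weighted mean. *)
Lemma bi_convex s t (l : R) : 0 <= s < 2^-1 -> 0 <= t < 2^-1 -> 0 <= l <= 1 ->
  L ((1 - l) * s + l * t) <= (1 - l) * L s + l * L t.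
Proof.
move=> s01 t01 l01; set m := (_ + _).
have m01 : 0 <= m < 2^-1 := convex_lagr_dom s01 t01 l01.
have hs := bi_tangent m01 s01; have ht := bi_tangent m01 t01.
have := @ler_wpM2l _ (1 - l) _ _ _ hs; have := @ler_wpM2l _ l _ _ _ ht.
move: l01 => /andP[l0 l1] /(_ l0) h1 /(_ ltac:(lra)) h2.
have e : (1 - l) * (b m * (s - m)) + l * (b m * (t - m)) = 0 by rewrite /m; ring.
lra.
Qed.

Lemma measurable_bi (f : R -> R) : f = L \/ f = b ->
  measurable_fun (@lagr_dom R) f.
Proof.
move=> H; rewrite lagr_dom_itv; apply: subspace_continuous_measurable_fun => //.
rewrite -lagr_dom_itv; case: H => ->; last exact: bi_b_continuous.
exact/dom_derivable_continuous/(bi_derivable LBI).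
Qed.

End born_infeld_theory.

(** * Passing to the limit in the difference quotients *)

Section fatou_le.
Context d (T : measurableType d) (R : realType) (mu : {measure set T -> \bar R}).

Lemma limn_einf_le (u : nat -> \bar R) (K : \bar R) :
  (forall n, (u n <= K)%E) -> (limn_einf u <= K)%E.
Proof.
move=> uK; rewrite limn_einf_lim; apply: lime_le; first exact: is_cvg_einfs.
apply: nearW => n; apply: le_trans (uK n).
by apply: ereal_inf_lbound; exists n => //=.
Qed.

Lemma fatou_le (f : nat -> T -> R) (g : T -> R) (K : \bar R) :
  (forall n, measurable_fun setT (f n)) ->
  (forall n x, 0 <= f n x) ->
  (forall x, f n x @[n --> \oo] --> g x) ->
  (forall n, (\int[mu]_x (f n x)%:E <= K)%E) ->
  (\int[mu]_x (g x)%:E <= K)%E.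
Proof.
move=> mf f0 fg fK.
have -> : (\int[mu]_x (g x)%:E = \int[mu]_x limn_einf (fun n => (f n x)%:E))%E.
  apply: eq_integral => x _; symmetry.
  have c : ((f n x)%:E @[n --> \oo] --> (g x)%:E)%E.
    by apply: cvg_EFin; [exact: nearW|exact: fg].
  by rewrite is_cvg_limn_einfE; [exact/cvg_lim|apply/cvg_ex; exists (g x)%:E].
apply: le_trans (limn_einf_le fK).
apply: (@fatou _ _ _ mu _ measurableT (fun n x => (f n x)%:E)) => //.
  by move=> n; apply/measurable_EFinP.
by move=> n x _; rewrite lee_fin.
Qed.

End fatou_le.

Section ae_eq_integrable.
Context d (T : measurableType d) (R : realType) (mu : {measure set T -> \bar R}).

(** Measurability of [g] is assumed separately because [mu] need not be complete. *)
Lemma ae_eq_integrable (f g : T -> \bar R) : measurable_fun setT g ->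
  ae_eq mu setT f g -> mu.-integrable setT f -> mu.-integrable setT g.
Proof.
move=> mg fg /integrableP[mf fi]; apply/integrableP; split => //.
rewrite -(_ : \int[mu]_x `|f x| = \int[mu]_x `|g x|)%E//.
apply: ge0_ae_eq_integral => //; try exact: measurableT_comp.
by apply: filterS fg => x /= fgx xT; rewrite fgx.
Qed.

End ae_eq_integrable.

(** * The variation inequality where the Lagrangian is finite *)

Section variation.
Context d (T : measurableType d) (R : realType) (mu : {measure set T -> \bar R}).
Variable L : R -> R.
Hypothesis LBI : born_infeld L.
Local Notation b := (dom_derive L).

Lemma measurable_bi_comp (h f : T -> R) :
  h = L \o f \/ h = b \o f ->
  (forall x, 0 <= f x < 2^-1) -> measurable_fun setT f -> measurable_fun setT h.
Proof.
move=> E fd mf.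
have H k : k = L \/ k = b -> measurable_fun setT (k \o f).
  move=> kE; apply: (@measurable_comp _ _ _ _ _ _ (@lagr_dom R)) => //.
  - by rewrite lagr_dom_itv; exact: measurable_itv.
  - by move=> _ [x _ <-]; exact: fd.
  - exact: (measurable_bi LBI).
by case: E => ->; apply: H; [left|right].
Qed.

(** In the application, [a] and [c] are the squared lengths of grad phi0 and grad w, and [e] is
    their scalar product. Then [D] is the squared length of grad phi0 - grad w, and [s t] is half
    the squared length of grad v_t, expanded in [t]. The positivity hypotheses on [D] and [s] record
    what remains of the vector structure. *)
Variables a c e : T -> R.
Let D x := a x - 2 * e x + c x.
Let A x := a x - e x.
Let s t x := 2^-1 * a x - t * A x + t ^+ 2 / 2 * D x.
Hypotheses (ma : measurable_fun setT a) (mc : measurable_fun setT c)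
  (me : measurable_fun setT e).
Hypotheses (a01 : forall x, 0 <= a x < 1) (c01 : forall x, 0 <= c x < 1).
Hypotheses (D0 : forall x, 0 <= D x) (s0 : forall t x, 0 <= s t x).

Let ms t : measurable_fun setT (s t).
Proof.
rewrite /s /A /D; apply: measurable_funD; [apply: measurable_funB|].
- exact: measurable_funM.
- by apply: measurable_funM => //; exact: measurable_funB.
- apply: measurable_funM => //; apply: measurable_funD => //.
  by apply: measurable_funB => //; exact: measurable_funM.
Qed.

Let a2 x : 0 <= 2^-1 * a x < 2^-1. Proof. by have := a01 x; lra. Qed.
Let c2 x : 0 <= 2^-1 * c x < 2^-1. Proof. by have := c01 x; lra. Qed.

Let s_le t x : 0 <= t <= 1 -> s t x <= (1 - t) * (2^-1 * a x) + t * (2^-1 * c x).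
Proof.
move=> t01; have Dx := D0 x.
(* The chord exceeds [s t x] by exactly half of this quantity. *)
have : 0 <= t * (1 - t) * D x by rewrite mulr_ge0// mulr_ge0; lra.
rewrite /s /A /D; lra.
Qed.

Let s2 t x : 0 <= t <= 1 -> 0 <= s t x < 2^-1.
Proof.
move=> t01; rewrite s0/=; apply: (le_lt_trans (s_le x t01)).
by have /andP[] := convex_lagr_dom (a2 x) (c2 x) t01.
Qed.

Hypothesis ia : mu.-integrable setT (fun x => (L (2^-1 * a x))%:E).
Hypothesis ic : mu.-integrable setT (fun x => (L (2^-1 * c x))%:E).
(** [r] stands for <rho, phi0 - w>, so that [var] is minimality tested against [v_t]. *)
Variable r : R.
Hypothesis var : forall t, 0 < t < 1 ->
  (\int[mu]_x (L (2^-1 * a x))%:E <= \int[mu]_x (L (s t x))%:E + (t * r)%:E)%E.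

Let q t x := t^-1 * (L (2^-1 * a x) - L (s t x)).
Let h x := L (2^-1 * a x) - L (2^-1 * c x).

Let is_ t : 0 <= t <= 1 -> mu.-integrable setT (fun x => (L (s t x))%:E).
Proof.
move=> t01.
apply: (@le_integrable _ _ _ mu _ measurableT _
  (fun x => ((1 - t)%:E * (L (2^-1 * a x))%:E + t%:E * (L (2^-1 * c x))%:E)%E)).
- apply/measurable_EFinP; apply: (@measurable_bi_comp _ (s t)); first by left.
    by move=> x; exact: s2.
  exact: ms.
- move=> x _; rewrite -!EFinM -EFinD /= lee_fin ger0_norm; last first.
    by apply: (bi_ge0 LBI); have /andP[] := s2 x t01.
  apply: le_trans (ler_norm _).
  apply: le_trans (bi_convex LBI (a2 x) (c2 x) t01).
  apply: (bi_nondecreasing LBI) => //; first exact: s_le.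
  by have /andP[] := convex_lagr_dom (a2 x) (c2 x) t01.
- by apply: integrableD => //; apply: integrableZl.
Qed.

(** By convexity, [L (s t x)] lies below the chord joining the values at [t = 0] and [t = 1], so its
    drop from [t = 0] is at least [t * h x]. *)
Let q_ge t x : 0 < t < 1 -> h x <= q t x.
Proof.
move=> t01; rewrite /q -ler_pdivrMl ?invrK ?invr_gt0; last by lra.
have t01' : 0 <= t <= 1 by lra.
have := bi_convex LBI (a2 x) (c2 x) t01'.
have : L (s t x) <= L ((1 - t) * (2^-1 * a x) + t * (2^-1 * c x)).
  apply: (bi_nondecreasing LBI) => //; first exact: s_le.
  by have /andP[] := convex_lagr_dom (a2 x) (c2 x) t01'.
rewrite /h; lra.
Qed.

(** Starting at 1/2 keeps every term strictly below 1, as [var] requires. *)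
Let tn n : R := n.+2%:R^-1.
Let tn01 n : 0 < tn n < 1.
Proof. by rewrite /tn invr_gt0 ltr0n /= invf_lt1 ?ltr1n ?ltr0n. Qed.

Let tn_cvg : tn n @[n --> \oo] --> (0 : R).
Proof.
have := @cvg_harmonic R; rewrite -(cvg_shiftS (@harmonic R)).
by apply: cvg_trans.
Qed.

(** The tangent inequalities at [s (tn n) x] and at [2^-1 * a x] enclose the quotient between two
    slopes with the same limit, since [b] is continuous. Squeezing replaces a chain rule, which
    would be awkward at points where [a x = 0] and only one-sided derivatives are available. *)
Let q_cvg x : q (tn n) x @[n --> \oo] --> b (2^-1 * a x) * A x.
Proof.
have slope n : (tn n)^-1 * (2^-1 * a x - s (tn n) x) = A x - tn n / 2 * D x.
  rewrite /s; have /andP[/gt_eqF/negbT t0 _] := tn01 n; by field.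
have cslope : A x - tn n / 2 * D x @[n --> \oo] --> A x.
  suff : A x - tn n / 2 * D x @[n --> \oo] --> A x - 0 / 2 * D x by rewrite !mul0r subr0.
  apply: cvgB; first exact: cvg_cst.
  by apply: cvgMr_tmp; apply: cvgMr_tmp; exact: tn_cvg.
have cs : s (tn n) x @[n --> \oo] --> 2^-1 * a x.
  suff : s (tn n) x @[n --> \oo] --> 2^-1 * a x - 0 * A x + 0 ^+ 2 / 2 * D x.
    by rewrite expr2 !mul0r subr0 addr0.
  apply: cvgD; [apply: cvgB; [exact: cvg_cst|]|].
    by apply: cvgMr_tmp; exact: tn_cvg.
  by apply: cvgMr_tmp; apply: cvgMr_tmp; apply: cvgM; exact: tn_cvg.
have cb : b (s (tn n) x) @[n --> \oo] --> b (2^-1 * a x).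
  have /subspace_continuousP/(_ _ (a2 x)) bc := bi_b_continuous LBI.
  apply: cvg_comp bc => P /= aP.
  have sP : \forall n \near \oo, lagr_dom (s (tn n) x) -> P (s (tn n) x).
    exact: (cs _ aP).
  have : \forall n \near \oo, P (s (tn n) x); last exact.
  near=> n; apply: (near sP n) => //; apply: s2; have := tn01 n; lra.
apply: (@squeeze_cvgr _ _ _ _ (fun n => b (s (tn n) x) * (A x - tn n / 2 * D x))
  (fun n => b (2^-1 * a x) * (A x - tn n / 2 * D x))).
- apply: nearW => n; rewrite -!slope /q.
  have t01' : 0 <= tn n <= 1 by have := tn01 n; lra.
  have t0 : 0 <= (tn n)^-1 by rewrite invr_ge0; have := tn01 n; lra.
  rewrite !(mulrCA _ (tn n)^-1); apply/andP; split; apply: ler_wpM2l => //.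
    exact: (bi_tangent LBI (s2 x t01') (a2 x)).
  have := (bi_tangent LBI (a2 x) (s2 x t01')); lra.
- exact: cvgM.
- by apply: cvgMl_tmp.
Unshelve. all: by end_near. Qed.

Lemma bi_variation_core :
  mu.-integrable setT (fun x => (b (2^-1 * a x) * (a x - e x))%:E) /\
  (\int[mu]_x (b (2^-1 * a x) * (a x - e x))%:E <= r%:E)%E.
Proof.
have ih : mu.-integrable setT (fun x => (h x)%:E).
  by rewrite /h; under eq_fun do rewrite EFinB; exact: integrableB.
have fh := integrable_fin_num measurableT ih.
have iq n : mu.-integrable setT (fun x => (q (tn n) x)%:E).
  rewrite /q; under eq_fun do rewrite EFinM EFinB.
  apply: integrableZl => //; apply: integrableB => //; apply: is_.
  by have := tn01 n; lra.
have q_le n : (\int[mu]_x (q (tn n) x)%:E <= r%:E)%E.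
  have t01 := tn01 n; have t01' : 0 <= tn n <= 1 by lra.
  rewrite /q; under eq_integral do rewrite EFinM EFinB.
  rewrite integralZl//; last by apply: integrableB => //; exact: is_.
  rewrite integralB//; last exact: is_.
  have /fineK Ea := integrable_fin_num measurableT ia.
  have /fineK Es := integrable_fin_num measurableT (is_ t01').
  have := var t01; rewrite -Ea -Es -EFinD -EFinB -EFinM !lee_fin => H.
  rewrite ler_pdivrMl; lra.
have mg : measurable_fun setT (fun x => b (2^-1 * a x) * (a x - e x)).
  apply: measurable_funM; last exact: measurable_funB.
  apply: (@measurable_bi_comp _ (fun x => 2^-1 * a x)); [by right|exact: a2|].
  exact: measurable_funM.
have mh : measurable_fun setT h by have /measurable_int/measurable_EFinP := ih.
(* Fatou is applied to [q - h], which is nonnegative by [q_ge]; the integrable [h] is added back at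
   the end. *)
have gh_le : (\int[mu]_x (b (2^-1 * a x) * (a x - e x) - h x)%:E
              <= r%:E - \int[mu]_x (h x)%:E)%E.
  apply: (@fatou_le _ _ _ _ (fun n x => q (tn n) x - h x)).
  - by move=> n; apply: measurable_funB => //; have /measurable_int/measurable_EFinP := iq n.
  - by move=> n x; rewrite subr_ge0 q_ge.
  - by move=> x; apply: cvgB; [exact: q_cvg|exact: cvg_cst].
  - move=> n; under eq_integral do rewrite EFinB.
    by rewrite integralB//; apply: leeB.
have gh0 x : 0 <= b (2^-1 * a x) * (a x - e x) - h x.
  rewrite subr_ge0 -(cvg_lim _ (@q_cvg x))//; apply: limr_ge.
    by apply/cvg_ex; eexists; exact: (@q_cvg x).
  by apply: nearW => n; exact: q_ge.
have igh : mu.-integrable setT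
    (fun x => (b (2^-1 * a x) * (a x - e x) - h x)%:E).
  apply/integrableP; split; first by apply/measurable_EFinP/measurable_funB.
  under eq_integral do rewrite /= ger0_norm//.
  apply: le_lt_trans gh_le _.
  by rewrite -(fineK fh) -EFinB ltry.
have E : (fun x => (b (2^-1 * a x) * (a x - e x))%:E) =
    (fun x => (b (2^-1 * a x) * (a x - e x) - h x)%:E + (h x)%:E)%E.
  by apply/funext => x; rewrite -EFinD subrK.
rewrite E; split; first exact: integrableD.
by rewrite integralD//; move: gh_le; rewrite -(fineK fh) leeBrDr.
Qed.

End variation.

(** * The variation inequality with infinite values on a null set *)

Section variation_ae.
Context d (T : measurableType d) (R : realType) (mu : {measure set T -> \bar R}).
Variable L : R -> R.
Hypothesis LBI : born_infeld L.
Local Notation b := (dom_derive L).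

Lemma lagr_ge0 (s : R) : 0 <= s -> (0 <= lagr L s)%E.
Proof.
rewrite /lagr => s0; case: ifPn => // s1; rewrite lee_fin; exact: (bi_ge0 LBI).
Qed.

Lemma measurable_lagr (f : T -> R) : (forall x, 0 <= f x) ->
  measurable_fun setT f -> measurable_fun setT (fun x => lagr L (f x)).
Proof.
move=> f0 mf; have m01 : measurable_fun setT (fun x => f x < 2^-1).
  exact: measurable_fun_ltr.
(* Nothing is known about [L] outside [lagr_dom]. Moving the argument to 0 in the branch that is
   discarded anyway makes the composition one with a function valued in [lagr_dom]. *)
have -> : (fun x => lagr L (f x)) = fun x => if f x < 2^-1
    then (L (if f x < 2^-1 then f x else 0))%:E else +oo%E.
  by apply/funext => x; rewrite /lagr; case: ifPn.
apply: measurable_fun_ifT => //; apply/measurable_EFinP.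
apply: (@measurable_bi_comp _ _ _ _ LBI _ (fun x => if f x < 2^-1 then f x else 0)).
- by left.
- by move=> x; case: ifPn => [->|_]; rewrite ?f0// lexx invr_gt0 ltr0n.
- exact: measurable_fun_ifT.
Qed.

Lemma measurable_lagr_b (f : T -> R) : (forall x, 0 <= f x) ->
  measurable_fun setT f -> measurable_fun setT (fun x => lagr_b L (f x)).
Proof.
move=> f0 mf; have m01 : measurable_fun setT (fun x => f x < 2^-1).
  exact: measurable_fun_ltr.
have -> : (fun x => lagr_b L (f x)) = fun x => if f x < 2^-1
    then (b (if f x < 2^-1 then f x else 0))%:E else +oo%E.
  by apply/funext => x; rewrite /lagr_b; case: ifPn.
apply: measurable_fun_ifT => //; apply/measurable_EFinP.
apply: (@measurable_bi_comp _ _ _ _ LBI _ (fun x => if f x < 2^-1 then f x else 0)).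
- by right.
- by move=> x; case: ifPn => [->|_]; rewrite ?f0// lexx invr_gt0 ltr0n.
- exact: measurable_fun_ifT.
Qed.

(** An integrable function is finite a.e., while the integrand is infinite as soon as [f x >= 1]. *)
Lemma lagr_int_ae (f : T -> R) : (forall x, 0 <= f x) ->
  measurable_fun setT f -> (\int[mu]_x lagr L (2^-1 * f x) < +oo)%E ->
  {ae mu, forall x, f x < 1}.
Proof.
move=> f0 mf fi.
have f20 x : 0 <= 2^-1 * f x by rewrite mulr_ge0 ?invr_ge0.
have : {ae mu, forall x, setT x -> lagr L (2^-1 * f x) \is a fin_num}.
  apply: integrable_ae => //; apply/integrableP; split.
    by apply: measurable_lagr => //; exact: measurable_funM.
  by under eq_integral do rewrite gee0_abs ?lagr_ge0//.
apply: filterS => x /(_ Logic.I); rewrite /lagr; case: ifPn => // H _.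
by move: H; rewrite -ltr_pdivlMl ?invr_gt0// invrK divff.
Qed.

Variables a c e : T -> R.
Let s t x := 2^-1 * a x - t * (a x - e x) + t ^+ 2 / 2 * (a x - 2 * e x + c x).
Hypotheses (ma : measurable_fun setT a) (mc : measurable_fun setT c)
  (me : measurable_fun setT e).
Hypotheses (a0 : forall x, 0 <= a x) (c0 : forall x, 0 <= c x).
Hypotheses (D0 : forall x, 0 <= a x - 2 * e x + c x)
  (s0 : forall t x, 0 <= s t x).
Hypotheses (Ja : (\int[mu]_x lagr L (2^-1 * a x) < +oo)%E)
  (Jc : (\int[mu]_x lagr L (2^-1 * c x) < +oo)%E).
Variable r : R.
Hypothesis var : forall t, 0 < t < 1 ->
  (\int[mu]_x lagr L (2^-1 * a x) <= \int[mu]_x lagr L (s t x) + (t * r)%:E)%E.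

(** Finite energies make [p] true a.e. Where it fails, all three data are replaced by 0: since [s]
    is linear in [(a, c, e)], cutting commutes with forming it, the positivity hypotheses survive,
    and the integrals do not change. *)
Let p x := (a x < 1) && (c x < 1).
Let cut (f : T -> R) x := if p x then f x else 0.

Let mp : measurable_fun setT p.
Proof. by apply: measurable_and; exact: measurable_fun_ltr. Qed.

Let mcut f : measurable_fun setT f -> measurable_fun setT (cut f).
Proof. by move=> mf; exact: measurable_fun_ifT. Qed.

Let p_ae : {ae mu, forall x, p x}.
Proof.
have := lagr_int_ae c0 mc Jc; have := lagr_int_ae a0 ma Ja.
by apply: filterS2 => x; rewrite /p => -> ->.
Qed.

Let st t x := 2^-1 * cut a x - t * (cut a x - cut e x) +
  t ^+ 2 / 2 * (cut a x - 2 * cut e x + cut c x).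

Let stE t x : st t x = if p x then s t x else 0.
Proof. by rewrite /st /s /cut; case: ifPn => // _; ring. Qed.

Let s_lt t x : p x -> 0 <= t <= 1 -> s t x < 2^-1.
Proof.
move=> /andP[a1 c1] t01.
have ad : lagr_dom (2^-1 * a x) by rewrite /lagr_dom /=; have := a0 x; lra.
have cd : lagr_dom (2^-1 * c x) by rewrite /lagr_dom /=; have := c0 x; lra.
have /andP[_] := convex_lagr_dom ad cd t01.
apply: le_lt_trans.
have : 0 <= t * (1 - t) * (a x - 2 * e x + c x) by rewrite mulr_ge0// mulr_ge0; lra.
rewrite /s; lra.
Qed.

Let lagr_cut (f g : T -> R) : measurable_fun setT f -> measurable_fun setT g ->
  (forall x, 0 <= f x) ->
  (forall x, 0 <= g x < 2^-1) -> (forall x, p x -> f x = g x) ->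
  (\int[mu]_x lagr L (f x) = \int[mu]_x (L (g x))%:E)%E.
Proof.
move=> mf mg f0 g01 fg.
apply: ge0_ae_eq_integral => //.
- exact: measurable_lagr.
- by apply/measurable_EFinP; apply: (@measurable_bi_comp _ _ _ _ LBI _ g) => //; left.
- by move=> x _; exact: lagr_ge0.
- by move=> x _; rewrite lee_fin; have /andP[] := g01 x; exact: (bi_ge0 LBI).
- move: p_ae; apply: filterS => x px _; rewrite fg// /lagr.
  by have /andP[_ ->] := g01 x.
Qed.

Let half_cut (f : T -> R) : f = a \/ f = c -> forall x, 0 <= 2^-1 * cut f x < 2^-1.
Proof.
move=> fac x; rewrite /cut /p; have := a0 x; have := c0 x.
by case: fac => ->; case: ifPn => [/andP[]|]; lra.
Qed.

Let mhalf (f : T -> R) : measurable_fun setT f -> measurable_fun setT (fun x => 2^-1 * f x).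
Proof. by move=> mf; exact: measurable_funM. Qed.

Let half_cutE (f : T -> R) : f = a \/ f = c -> measurable_fun setT f ->
  (forall x, 0 <= f x) ->
  (\int[mu]_x lagr L (2^-1 * f x) = \int[mu]_x (L (2^-1 * cut f x))%:E)%E.
Proof.
move=> fac mf f0; apply: lagr_cut.
- exact: mhalf.
- exact/mhalf/mcut.
- by move=> x; rewrite mulr_ge0 ?invr_ge0.
- exact: half_cut.
- by move=> x px; rewrite /cut px.
Qed.

Let ihalf (f : T -> R) : f = a \/ f = c -> measurable_fun setT f ->
  (forall x, 0 <= f x) -> (\int[mu]_x lagr L (2^-1 * f x) < +oo)%E ->
  mu.-integrable setT (fun x => (L (2^-1 * cut f x))%:E).
Proof.
move=> fac mf f0; rewrite half_cutE// => foo; apply/integrableP; split.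
  apply/measurable_EFinP; apply: (@measurable_bi_comp _ _ _ _ LBI _ (fun x => 2^-1 * cut f x)).
  - by left.
  - exact: half_cut.
  - exact/mhalf/mcut.
rewrite (eq_integral (fun x => (L (2^-1 * cut f x))%:E))// => x _.
by have /andP[h0 h1] := half_cut fac x; rewrite /= ger0_norm// (bi_ge0 LBI).
Qed.

Lemma bi_variation :
  mu.-integrable setT (fun x => lagr_b L (2^-1 * a x) * (a x - e x)%:E)%E /\
  (\int[mu]_x (lagr_b L (2^-1 * a x) * (a x - e x)%:E) <= r%:E)%E.
Proof.
have ms t : measurable_fun setT (s t).
  rewrite /s; apply: measurable_funD; [apply: measurable_funB|].
  - exact: measurable_funM.
  - by apply: measurable_funM => //; exact: measurable_funB.
  - apply: measurable_funM => //; apply: measurable_funD => //.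
    by apply: measurable_funB => //; exact: measurable_funM.
have [i1 i2] : mu.-integrable setT
    (fun x => (b (2^-1 * cut a x) * (cut a x - cut e x))%:E) /\
  (\int[mu]_x (b (2^-1 * cut a x) * (cut a x - cut e x))%:E <= r%:E)%E.
  apply: (@bi_variation_core _ _ _ mu L LBI (cut a) (cut c) (cut e)); try exact: mcut.
  - by move=> x; have := half_cut (or_introl erefl) x; lra.
  - by move=> x; have := half_cut (or_intror erefl) x; lra.
  - by move=> x; rewrite /cut; case: ifPn => // _; rewrite mulr0 subrr addr0.
  - by move=> t x; have := stE t x; rewrite /st => ->; case: ifPn.
  - by apply: ihalf => //; left.
  - by apply: ihalf => //; right.
  - move=> t t01; have := var t01.
    rewrite half_cutE//; last by left.
    rewrite (@lagr_cut (s t) (st t))//.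
    + by rewrite (funext (stE t)); exact: measurable_fun_ifT.
    + move=> x; rewrite stE; case: ifPn => px; last by rewrite lexx invr_gt0 ltr0n.
      by rewrite s0 s_lt//; lra.
    + by move=> x px; rewrite stE px.
have E : ae_eq mu setT (fun x => (b (2^-1 * cut a x) * (cut a x - cut e x))%:E)
   (fun x => lagr_b L (2^-1 * a x) * (a x - e x)%:E)%E.
  move: p_ae; apply: filterS => x px _; rewrite /cut px /lagr_b ifT//.
  by have /andP[a1 _] := px; lra.
have mF : measurable_fun setT (fun x => lagr_b L (2^-1 * a x) * (a x - e x)%:E)%E.
  apply: emeasurable_funM.
    apply: measurable_lagr_b; last exact: mhalf.
    by move=> x; rewrite mulr_ge0 ?invr_ge0.
  by apply/measurable_EFinP; exact: measurable_funB.
split; first exact: ae_eq_integrable mF E i1.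
apply: le_trans i2; rewrite le_eqVlt; apply/orP; left; apply/eqP; symmetry.
by apply: ae_eq_integral E => //; have /measurable_int := i1.
Qed.

End variation_ae.

(** * Lebesgue measure on row vectors and integration by parts *)

Section measurable_rV.
Context {R : realType} {n : nat}.

Lemma measurable_rV_continuous (f : 'rV[R]_n -> R) : continuous f ->
  measurable_fun setT f.
Proof.
move=> cf; apply: (measurability _ (RGenOpens.measurableE R)) => //.
move=> _ [_ [a [b ->] <-]]; rewrite setTI; apply: sub_sigma_algebra.
by apply: open_comp; [move=> x _; exact: cf|exact: interval_open].
Qed.

Lemma measurable_rV_coord (i : 'I_n) :
  measurable_fun setT (fun x : 'rV[R]_n => x ord0 i).
Proof. by apply: measurable_rV_continuous => x; exact: coord_continuous. Qed.

Lemma measurable_rV_open (U : set 'rV[R]_n) : open U -> measurable U.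
Proof. exact: sub_sigma_algebra. Qed.

Lemma rV_ballE (c : 'rV[R]_n) (e : R) : 0 < e ->
  ball c e = \bigcap_(i : 'I_n) [set x | `|c ord0 i - x ord0 i| < e].
Proof.
move=> e0; apply/seteqP; split => x /=.
  by move=> [_ H] i _; exact: H.
by move=> H; split => // i j; rewrite ord1; exact: H.
Qed.

(** An open set is a countable union of balls, and a ball of the sup norm is a finite intersection
    of coordinate slabs. *)
Lemma measurable_to_rV d (T : measurableType d) (g : T -> 'rV[R]_n) :
  (forall i, measurable_fun setT (fun x => g x ord0 i)) -> measurable_fun setT g.
Proof.
move=> mg.
apply: (@measurability _ _ _ _ setT _ (@open 'rV[R]_n)) => //.
move=> _ [U oU <-]; rewrite setTI.
have [F [-> FB]] := rV_open_bigcup oU.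
rewrite preimage_bigcup; apply: bigcup_measurable => k _.
have [->|[c [e [e0 ->]]]] := FB k; first by rewrite preimage_set0.
rewrite rV_ballE// preimage_bigcap; apply: fin_bigcap_measurable => // i _.
rewrite -[X in measurable X]setTI.
have -> : g @^-1` [set x | `|c ord0 i - x ord0 i| < e] =
   (fun x => g x ord0 i) @^-1` (ball (c ord0 i) e) by [].
by apply: mg => //; exact: measurable_ball.
Qed.

End measurable_rV.

(** The hypothesis on [g] makes the two difference quotients the same function of [h], so
    directional derivatives can be transported without a chain rule and without Frechet
    differentiability. *)
Lemma is_derive_along {R : realType} (V W : normedModType R) (g : W -> V)
    (f : V -> R) (x w : W) (v : V) (l : R) :
  (forall h : R, g (h *: w + x) = h *: v + g x) ->
  is_derive (g x) v f l -> is_derive x w (fun y => f (g y)) l.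
Proof.
move=> gE [d1 d2].
have E : (fun h : R => h^-1 *: (((fun y => f (g y)) \o shift x) (h *: w) - f (g x)))
    = (fun h => h^-1 *: ((f \o shift (g x)) (h *: v) - f (g x))).
  by apply/funext => h /=; rewrite gE.
by split; rewrite /derivable /derive E.
Qed.

Section rV_leb_theory.
Context {R : realType}.
Local Notation leb n := (@rV_leb R n).

Lemma rV_leb_ball_lty n (M : R) : (leb n (ball (0%R : 'rV[R]_n) M) < +oo)%E.
Proof.
(* Matrix balls include the condition that the radius is positive, so they are empty here, even in
   dimension 0. *)
have [M0|M0] := leP M 0.
  rewrite (_ : ball _ _ = set0) ?measure0// -subset0 => x -[].
  by rewrite ltNge M0.
elim: n => [|n IH].
  rewrite /= diracE; apply: le_lt_trans (ltry 1); rewrite lee_fin.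
  by case: (_ \in _).
rewrite /= /rV_leb_step /pushforward.
rewrite (_ : _ @^-1` _ = (ball (0:R) M : set (measurableTypeR R)) `*` ball (0 : 'rV[R]_n) M); last first.
  apply/seteqP; split => -[a v] /=.
    move=> [_ H]; split.
      by have := H ord0 ord0; rewrite rV_cons0 !mxE.
    by split=> // i j; have := H i (lift ord0 j); rewrite !ord1 rV_consS !mxE.
  move=> [H1 [_ H2]]; split=> // i j; rewrite ord1.
  have [->|j0] := eqVneq j ord0; first by rewrite rV_cons0 mxE.
  have [k0 ->] : exists k0, j = lift ord0 k0.
    by case: (unliftP ord0 j) j0 => [k0 ->|->]; [exists k0|rewrite eqxx].
  by rewrite rV_consS; have := H2 ord0 k0; rewrite !mxE.
rewrite product_measure1E//; last 2 first.
- exact: measurable_ball.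
- by apply: measurable_rV_open; exact: ball_open.
have lb : lebesgue_measure (ball (0 : R) M : set (measurableTypeR R)) = (M *+ 2)%:E.
  exact: lebesgue_measure_ball (ltW M0).
apply: lte_mul_pinfty; [exact: measure_ge0| |exact: IH].
have : (M *+ 2)%:E \is a fin_num by [].
by rewrite -lb.
Qed.

Lemma bounded_support_integrable n (f : 'rV[R]_n -> R) (M C : R) :
  measurable_fun setT f -> (forall x, `|f x| <= C) ->
  (forall x, ~ ball 0 M x -> f x = 0) ->
  (leb n).-integrable setT (EFin \o f).
Proof.
move=> mf fC f0.
have mB : measurable (ball (0 : 'rV[R]_n) M).
  by apply: measurable_rV_open; exact: ball_open.
apply: (@le_integrable _ _ _ (leb n) _ measurableT _
  (EFin \o (fun x => C * \1_(ball (0 : 'rV[R]_n) M) x))).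
- exact/measurable_EFinP.
- move=> x _; rewrite /= lee_fin indicE.
  have [xB|xB] := pselect (ball (0 : 'rV[R]_n) M x).
    by rewrite mem_set// mulr1 (le_trans (fC x))// ler_norm.
  by rewrite memNset// mulr0 f0.
- under [X in integrable _ _ X]eq_fun do rewrite /= EFinM.
  apply: integrableZl => //.
  apply/integrableP; split; first exact/measurable_EFinP.
  under eq_integral do rewrite /= ger0_norm//.
  by rewrite integral_indic// setIT; exact: rV_leb_ball_lty.
Qed.

Lemma integral_rV_cons n (f : 'rV[R]_n.+1 -> \bar R) :
  (leb n.+1).-integrable setT f ->
  ((@lebesgue_measure R) \x leb n)%E.-integrable setT (f \o @rV_cons R n) /\
  (\int[leb n.+1]_x f x = \int[(@lebesgue_measure R) \x leb n]_p f (rV_cons p))%E.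
Proof.
move=> fi; have mc := @measurable_rV_cons R n.
have fi2 : ((@lebesgue_measure R) \x leb n)%E.-integrable setT (f \o @rV_cons R n).
  have /integrableP[mf foo] := fi; apply/integrableP; split.
    exact: measurableT_comp.
  move: foo; rewrite /= ge0_integral_pushforward//; exact: measurableT_comp.
split => //; rewrite /= integral_pushforward//.
by have /measurable_int := fi.
Qed.

Lemma normr_rV_cons_le n (t : R) (y : 'rV[R]_n) (M : R) :
  ball 0 M (rV_cons (t, y) : 'rV[R]_n.+1) -> `|t| < M /\ ball (0 : 'rV[R]_n) M y.
Proof.
move=> [M0 H]; split.
  by have := H ord0 ord0; rewrite rV_cons0 /ball/= !mxE sub0r normrN.
by split => // i j; have := H i (lift ord0 j); rewrite !ord1 rV_consS !mxE.
Qed.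

Lemma rV_consDl n (t s : R) (y : 'rV[R]_n) :
  rV_cons (s + t, y) = s *: delta_mx ord0 ord0 + rV_cons (t, y).
Proof.
apply/rowP => j; rewrite [RHS]mxE.
have [->|j0] := eqVneq j ord0; first by rewrite !rV_cons0 !mxE !eqxx mulr1.
case: (unliftP ord0 j) j0 => [k -> _|->]; last by rewrite eqxx.
by rewrite !rV_consS !mxE /= mulr0 add0r.
Qed.

Lemma rV_consDr n (t s : R) (i : 'I_n) (y : 'rV[R]_n) :
  rV_cons (t, s *: delta_mx ord0 i + y) =
  s *: delta_mx ord0 (lift ord0 i) + rV_cons (t, y).
Proof.
apply/rowP => j; rewrite [RHS]mxE.
have [->|j0] := eqVneq j ord0; first by rewrite !rV_cons0 !mxE /= mulr0 add0r.
case: (unliftP ord0 j) j0 => [k -> _|->]; last by rewrite eqxx.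
by rewrite !rV_consS !mxE /= (inj_eq (@lift_inj _ _)).
Qed.

Lemma ball_rV_cons n (t s e : R) (x y : 'rV[R]_n) :
  ball t e s -> ball x e y -> ball (rV_cons (t, x)) e (rV_cons (s, y)).
Proof.
move=> ts [e0 xy]; split => // i j; rewrite ord1.
have [->|j0] := eqVneq j ord0; first by rewrite !rV_cons0.
case: (unliftP ord0 j) j0 => [k -> _|->]; last by rewrite eqxx.
by rewrite !rV_consS; exact: xy.
Qed.

Lemma continuous_rV_consr n (t : R) :
  continuous (fun y : 'rV[R]_n => (rV_cons (t, y) : 'rV[R]_n.+1)).
Proof.
move=> y A /nbhs_ballP[e e0 eA]; apply/nbhs_ballP; exists e => // z yz.
by apply: eA; apply: ball_rV_cons => //; exact: ballxx.
Qed.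

Lemma continuous_rV_consl n (y : 'rV[R]_n) :
  continuous (fun t : R => (rV_cons (t, y) : 'rV[R]_n.+1)).
Proof.
move=> t A /nbhs_ballP[e e0 eA]; apply/nbhs_ballP; exists e => // z tz.
by apply: eA; apply: ball_rV_cons => //; exact: ballxx.
Qed.

(* The induction peels off the coordinate that [rV_leb] integrates first. *)
Lemma integral_partial0 n (i : 'I_n) (f df : 'rV[R]_n -> R) (M C : R) :
  continuous df -> (forall x, `|df x| <= C) ->
  (forall x, ~ ball 0 M x -> f x = 0) -> (forall x, ~ ball 0 M x -> df x = 0) ->
  (forall x, is_derive x (delta_mx ord0 i) f (df x)) ->
  (\int[leb n]_x (df x)%:E = 0)%E.
Proof.
elim: n i f df => [|n IH] i f df cdf dfC f0 df0 fdf; first by case: (i).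
have idf : (leb n.+1).-integrable setT (EFin \o df).
  apply: (@bounded_support_integrable _ _ M C) => //.
  exact: measurable_rV_continuous.
have [icons ->] := integral_rV_cons idf.
have [i0|i0] := eqVneq i ord0; last first.
  have [k ik] : exists k, i = lift ord0 k.
    by clear fdf; case: (unliftP ord0 i) i0 => [k ->|->]; [exists k|rewrite eqxx].
  (* When [i] is not the first coordinate, that coordinate is frozen and the induction hypothesis
     kills every slice. *)
  rewrite -integral12_prod_meas1//.
  apply: integral0_eq => t _ /=.
  apply: (IH k (fun y => f (rV_cons (t, y)))) => //.
  - move=> y; apply: continuous_comp; [exact: continuous_rV_consr|exact: cdf].
  - by move=> y yM; apply: f0 => /normr_rV_cons_le[].
  - by move=> y yM; apply: df0 => /normr_rV_cons_le[].
  - move=> y; apply: (@is_derive_along R _ _ (fun y => rV_cons (t, y)) f _ _ (delta_mx ord0 i)).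
    by move=> h; rewrite rV_consDr ik.
rewrite -integral21_prod_meas1//; apply: integral0_eq => y _ /=.
have [M0|M0] := leP M 0.
  by apply: integral0_eq => t _; rewrite df0// => -[]; rewrite ltNge M0.
(* When [i] is the first coordinate, each line is treated by the fundamental theorem of calculus.
   The endpoints [- M] and [M] already lie outside the open ball, so both boundary terms vanish. *)
transitivity (\int[lebesgue_measure]_(t in `[(- M)%R, M]) (df (rV_cons (t, y)))%:E)%E.
  rewrite [RHS]integral_mkcond; apply: eq_integral => t _; rewrite patchE.
  case: ifPn => //; rewrite notin_setE /= in_itv /= => tM; rewrite df0//.
  by move=> /normr_rV_cons_le[+ _]; rewrite ltr_norml => /andP[a1 a2]; apply: tM; rewrite !ltW.
have Fd (t : R) : is_derive t 1 (fun t => f (rV_cons (t, y))) (df (rV_cons (t, y))).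
  apply: (@is_derive_along R _ R^o (fun t : R => rV_cons (t, y)) f _ _ (delta_mx ord0 i)).
  by move=> h; rewrite i0 -rV_consDl [h *: 1]mulr1.
have Fc : continuous (fun t => f (rV_cons (t, y))).
  by move=> t; apply/differentiable_continuous/derivable1_diffP; have [] := Fd t.
rewrite (continuous_FTC2 (F := fun t => f (rV_cons (t, y)))).
- rewrite !f0 ?subee// => /normr_rV_cons_le[+ _]; by rewrite ?normrN gtr0_norm// ltxx.
- by rewrite gtrN.
- apply: continuous_subspaceT => t.
  by apply: continuous_comp; [exact: continuous_rV_consl|exact: cdf].
- split.
  + by move=> t _; have [] := Fd t.
  + exact/cvg_at_right_filter/Fc.
  + exact/cvg_at_left_filter/Fc.
- by move=> t _; rewrite derive1E; have [_ ->] := Fd t.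
Qed.

End rV_leb_theory.

(** * Functions with zero integral over all boxes *)

Section density_measure.
Context d (T : measurableType d) (R : realType) (mu : {measure set T -> \bar R}).

(** The proofs [mf] and [f0] are arguments so that the measure structure can be inferred from the
    term itself. *)
Definition density_measure (f : T -> \bar R) (mf : measurable_fun setT f)
  (f0 : forall x, (0 <= f x)%E) (A : set T) : \bar R := (\int[mu]_(x in A) f x)%E.

Variables (f : T -> \bar R) (mf : measurable_fun setT f)
  (f0 : forall x, (0 <= f x)%E).

Let density0 : density_measure mf f0 set0 = 0%E.
Proof. exact: integral_set0. Qed.

Let density_ge0 A : (0 <= density_measure mf f0 A)%E.
Proof. by apply: integral_ge0 => x _. Qed.

Let density_additive : semi_sigma_additive (density_measure mf f0).
Proof. exact: semi_sigma_additive_nng_induced. Qed.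

HB.instance Definition _ := isMeasure.Build _ _ _ (density_measure mf f0)
  density0 density_ge0 density_additive.

End density_measure.

Section boxes.
Context {R : realType} {n : nat}.
Local Notation E := 'rV[R]_n.
Local Notation leb := (@rV_leb R n).

Definition rV_box (a b : E) : set E :=
  [set x | forall i, a ord0 i < x ord0 i < b ord0 i].

Lemma rV_boxE (a b : E) :
  rV_box a b = \bigcap_(i : 'I_n) ((fun x : E => x ord0 i) @^-1` `]a ord0 i, b ord0 i[).
Proof.
apply/seteqP; split => x /= H i; last by have := H i Logic.I; rewrite /= in_itv.
by move=> _; rewrite /= in_itv /=; exact: H.
Qed.

Lemma measurable_rV_box (a b : E) : measurable (rV_box a b).
Proof.
rewrite rV_boxE; apply: fin_bigcap_measurable => // i _.
rewrite -[X in measurable X]setTI.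
by apply: measurable_rV_coord => //; exact: measurable_itv.
Qed.

Lemma rV_box_setI (a b c d : E) : rV_box a b `&` rV_box c d =
  rV_box (\row_i Num.max (a ord0 i) (c ord0 i)) (\row_i Num.min (b ord0 i) (d ord0 i)).
Proof.
apply/seteqP; split => x /=.
  by move=> [H1 H2] i; rewrite !mxE gt_max lt_min; have /andP[-> ->] := H1 i; exact: H2.
by move=> H; split => i; have := H i; rewrite !mxE gt_max lt_min => /andP[/andP[? ?] /andP[? ?]]; apply/andP.
Qed.

Lemma ball_rV_box (c : E) (e : R) : 0 < e ->
  ball c e = rV_box (\row_i (c ord0 i - e)) (\row_i (c ord0 i + e)).
Proof.
move=> e0; rewrite rV_ballE//; apply/seteqP; split => x /= H i.
  by have := H i Logic.I; rewrite /= !mxE distrC ltr_distl.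
by move=> _ /=; have := H i; rewrite !mxE distrC ltr_distl.
Qed.

Lemma rV_box_sub_ball (a b : E) : exists M : R, rV_box a b `<=` ball 0 M.
Proof.
exists (1 + \sum_i (`|a ord0 i| + `|b ord0 i|)).
have S0 : 0 <= \sum_i (`|a ord0 i| + `|b ord0 i|) by apply: sumr_ge0 => i _; rewrite addr_ge0.
move=> x H; rewrite rV_ballE; last by rewrite ltr_wpDr.
move=> i _ /=; rewrite mxE sub0r normrN; have /andP[xa xb] := H i.
apply: (@le_lt_trans _ _ (`|a ord0 i| + `|b ord0 i|)).
  rewrite ler_norml; have := ler_norm (b ord0 i); have := lerNnormlW (lexx `|a ord0 i|).
  have := normr_ge0 (a ord0 i); have := normr_ge0 (b ord0 i); lra.
rewrite ltr_pwDl// (bigD1 i)//= lerDl; apply: sumr_ge0 => j _; rewrite addr_ge0//.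
Qed.

(** Open sets are countable unions of balls, and balls of the sup norm are boxes. *)
Lemma rV_measurable_boxes :
  (@measurable _ E) = <<s [set A | exists a b, A = rV_box a b] >>.
Proof.
apply/seteqP; split => A; last first.
  apply: smallest_sub; first exact: sigma_algebra_measurable.
  by move=> _ [a [b ->]]; exact: measurable_rV_box.
apply: smallest_sub; first exact: smallest_sigma_algebra.
move=> U oU; have [F [-> FB]] := rV_open_bigcup oU.
pose G := [set A | exists a b : E, A = rV_box a b].
have H k : <<s G >> (F k).
  have [->|[c [e [e0 ->]]]] := FB k; first exact: sigma_algebra0.
  by apply: sub_sigma_algebra; rewrite ball_rV_box//; do 2 eexists.
exact: sigma_algebra_bigcup.
Qed.

(** The positive and negative parts of [h] are densities of two measures that agree on boxes, hence
    on all Borel sets by uniqueness on a pi-system. On the set where [h] is nonnegative the second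
    measure vanishes, so the first does too, and it has no mass elsewhere; then both are 0. *)
Lemma rV_ae_eq0 (h : E -> R) : measurable_fun setT h ->
  (forall a b, leb.-integrable (rV_box a b) (EFin \o h)) ->
  (forall a b, \int[leb]_(x in rV_box a b) (h x)%:E = 0)%E ->
  {ae leb, forall x, h x = 0}.
Proof.
move=> mh ih h0; pose f := EFin \o h.
have mf : measurable_fun setT f by exact/measurable_EFinP.
have mp := measurable_funepos mf; have mn := measurable_funeneg mf.
pose m1 := density_measure leb mp (funepos_ge0 f).
pose m2 := density_measure leb mn (funeneg_ge0 f).
pose G := [set A : set E | exists a b, A = rV_box a b].
have m12 A : measurable A -> m1 A = m2 A.
  apply: (@measure_unique _ _ _ G (fun k => ball 0 k.+1%:R)).
  - exact: rV_measurable_boxes.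
  - by move=> _ _ [a [b ->]] [c [d ->]]; rewrite rV_box_setI; do 2 eexists.
  - by move=> k; rewrite ball_rV_box//; do 2 eexists.
  (* To place [x] in some ball of integer radius, it is viewed as a point of the box of half-width 1
     around itself. *)
  - apply/seteqP; split => // x _; have [M xM] := rV_box_sub_ball (x - const_mx 1) (x + const_mx 1).
    exists (Num.truncn M) => //; apply: (@le_ball _ _ _ M).
      by apply/ltW; exact: truncnS_gt.
    by apply: xM => i; rewrite !mxE ltrDl ltrBlDr ltrDl ltr01.
  - move=> _ [a [b ->]]; rewrite /= /density_measure.
    have iab : leb.-integrable (rV_box a b) f := ih a b.
    have pq : (\int[leb]_(x in rV_box a b) f^\+ x -
        \int[leb]_(x in rV_box a b) f^\- x = 0)%E by rewrite -integralE; exact: h0.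
    have mB := measurable_rV_box a b.
    move: (integrable_fin_num mB (integrable_funepos mB iab))
      (integrable_fin_num mB (integrable_funeneg mB iab)) pq.
    move=> /fineK <- /fineK <-; rewrite -EFinB => -[] /eqP.
    by rewrite subr_eq0 => /eqP ->.
  - move=> k; rewrite ball_rV_box//.
    set a := \row_i _; set b := \row_i _.
    have iab : leb.-integrable (rV_box a b) f := ih a b.
    have mB := measurable_rV_box a b.
    have := integrable_fin_num mB (integrable_funepos mB iab).
    by rewrite ge0_fin_numE; [exact|exact: integral_ge0].
have mP : measurable [set x | 0 <= h x].
  have -> : [set x | 0 <= h x] = h @^-1` `[0, +oo[.
    by apply/seteqP; split => x /=; rewrite in_itv /= andbT.
  by rewrite -[X in measurable X]setTI; apply: mh => //; exact: measurable_itv.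
have m2P : m2 [set x | 0 <= h x] = 0%E.
  apply: integral0_eq => x /= hx; rewrite funenegE /f /=.
  by apply/max_idPr; rewrite lee_fin oppr_le0.
have m1T : m1 setT = 0%E.
  rewrite -m2P -m12// /m1 /= /density_measure [RHS]integral_mkcond.
  apply: eq_integral => x _; rewrite patchE; case: ifPn => //.
  rewrite notin_setE /= => /negP; rewrite -ltNge => hx.
  by rewrite funeposE /f /=; apply/max_idPr; rewrite lee_fin ltW.
have m2T : m2 setT = 0%E by rewrite -m12.
have : (\int[leb]_x `|f x| = 0)%E.
  rewrite (eq_integral (f^\+ \+ f^\-)%E); last first.
    by move=> x _; exact: (congr1 (@^~ x) (fune_abse f)).
  rewrite ge0_integralD//.
  by move: m1T m2T; rewrite /m1 /m2 /= /density_measure => -> ->; rewrite adde0.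
move/ae_eq_integral_abs => /(_ measurableT mf); apply: filterS => x /(_ Logic.I) /=.
by move=> [].
Qed.

End boxes.

(** * C^1 approximation of indicators of boxes *)

Section smooth_step.
Context {R : realType}.
Implicit Types s t : R.

Definition pos_part s : R := Num.max s 0.

Lemma pos_part_ge0 s : 0 <= pos_part s.
Proof. by rewrite /pos_part le_max lexx orbT. Qed.

Lemma pos_part_continuous : continuous pos_part.
Proof. by move=> s; apply: continuous_max; [exact: cvg_id|exact: cvg_cst]. Qed.

Lemma is_derive_pos_part_sqr s :
  is_derive s 1 (fun s => pos_part s ^+ 2) (2 * pos_part s).
Proof.
(* An error bound by [|h|] that is uniform in [s] treats the kink at 0 like any other point. *)
have H (h : R) : h != 0 ->
    `|2 * pos_part s - h^-1 *: (pos_part (h *: 1 + s) ^+ 2 - pos_part s ^+ 2)| <= `|h|.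
  move=> h0; rewrite -[h *: 1]/(h * 1) mulr1.
  have -> : 2 * pos_part s - h^-1 *: (pos_part (h + s) ^+ 2 - pos_part s ^+ 2)
     = h^-1 * (2 * pos_part s * h - (pos_part (h + s) ^+ 2 - pos_part s ^+ 2)).
    by rewrite mulrBr [h^-1 * (_ * h)]mulrCA mulVf// mulr1.
  rewrite normrM normfV ler_pdivrMl ?normr_gt0// -normrM -expr2 [X in _ <= X]ger0_norm ?sqr_ge0//.
  rewrite ler_norml /pos_part.
  by case: (leP s 0) => s0; case: (leP (h + s) 0) => hs0; apply/andP; split; nra.
have c : h^-1 *: (pos_part (h *: 1 + s) ^+ 2 - pos_part s ^+ 2) @[h --> 0^']
    --> 2 * pos_part s.
  apply/cvgrPdist_le => e e0; near=> h; apply: (le_trans (H h _)).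
    by near: h; exact: nbhs_dnbhs_neq.
  by near: h; apply: nbhs_dnbhs; near=> h; rewrite -[h]subr0 distrC ltW//; near: h; exact: nbhsx_ballx.
by split; [apply/cvg_ex; eexists; exact: c|exact: cvg_lim c].
Unshelve. all: by end_near. Qed.

(** This is m^2 / (1 + m^2) with [m = pos_part s]: C^1 because the square of [pos_part] is, zero for
    [s <= 0], and tending to 1 under dilation for [s > 0]. *)
Definition smooth_step s : R := 1 - (1 + pos_part s ^+ 2)^-1.
Definition smooth_step' s : R := (1 + pos_part s ^+ 2) ^- 2 * (2 * pos_part s).

Let den_gt0 s : 0 < 1 + pos_part s ^+ 2.
Proof. by rewrite ltr_pwDl// sqr_ge0. Qed.

Let den_neq0 s : 1 + pos_part s ^+ 2 != 0.
Proof. by rewrite gt_eqF. Qed.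

Lemma is_derive_smooth_step s : is_derive s 1 smooth_step (smooth_step' s).
Proof.
have d := is_derive_pos_part_sqr s.
have d1 : is_derive s 1 (fun s => 1 + pos_part s ^+ 2) (2 * pos_part s).
  have := @is_deriveD R R^o R^o (cst (1 : R)) (fun s => pos_part s ^+ 2) s 1 0 _ _ d.
  by rewrite add0r; apply; exact: is_derive_cst.
have d2 := @is_deriveV R (fun s => 1 + pos_part s ^+ 2) s _ 1 (den_neq0 s) d1.
have := @is_deriveB R R^o R^o (cst (1 : R)) (fun s => (1 + pos_part s ^+ 2)^-1) s 1 0 _ _ d2.
rewrite /smooth_step' sub0r scaleNr opprK; apply; exact: is_derive_cst.
Qed.

Lemma smooth_step_continuous : continuous smooth_step.
Proof.
move=> s; apply/differentiable_continuous/derivable1_diffP.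
by have [] := is_derive_smooth_step s.
Qed.

Lemma smooth_step'_continuous : continuous smooth_step'.
Proof.
move=> s; have c := @pos_part_continuous s.
apply: cvgM; last by apply: cvgMl_tmp.
apply: cvgV; first by rewrite expf_neq0.
have c1 : 1 + pos_part t ^+ 2 @[t --> s] --> 1 + pos_part s ^+ 2.
  by apply: cvgD; [exact: cvg_cst|exact: (cvgM c c)].
exact: (cvgM c1 c1).
Qed.

Lemma smooth_step_ge0 s : 0 <= smooth_step s.
Proof. by rewrite /smooth_step subr_ge0 invf_le1// lerDl sqr_ge0. Qed.

Lemma smooth_step_le1 s : smooth_step s <= 1.
Proof. by rewrite /smooth_step gerBl invr_ge0 ltW. Qed.

Lemma smooth_step_le0 s : s <= 0 -> smooth_step s = 0.
Proof.
by move=> s0; rewrite /smooth_step /pos_part (max_idPr s0) expr0n addr0 invr1 subrr.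
Qed.

Lemma smooth_step'_le0 s : s <= 0 -> smooth_step' s = 0.
Proof. by move=> s0; rewrite /smooth_step' /pos_part (max_idPr s0) !mulr0. Qed.

Lemma smooth_step_cvg1 s : 0 < s ->
  smooth_step (k.+1%:R * s) @[k --> \oo] --> (1 : R).
Proof.
move=> s0; rewrite -[X in _ --> X]subr0; apply: cvgB; first exact: cvg_cst.
(* The defect decays like 1/k^2; the cruder bound by 1/k lets the known limit of [harmonic]
   conclude. *)
apply: (@squeeze_cvgr _ _ _ _ (fun=> 0) (fun k => (harmonic k) * (s^-1 ^+ 2))).
- apply: nearW => k; rewrite invr_ge0 ltW//= /harmonic /=.
  have ks0 : 0 < k.+1%:R * s by rewrite mulr_gt0.
  rewrite /pos_part (max_idPl (ltW ks0)).
  rewrite exprVn -invfM lef_pV2 ?posrE ?mulr_gt0 ?exprn_gt0 ?ltr_pwDl ?sqr_ge0//.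
  rewrite exprMn ler_wpDl// ler_wpM2r ?sqr_ge0//.
  by rewrite expr2 ler_peMr// ler1n.
- exact: cvg_cst.
- rewrite -[X in _ --> X](mul0r (s^-1 ^+ 2)); apply: cvgMr_tmp; exact: cvg_harmonic.
Qed.

Lemma smooth_step'_bounded s : `|smooth_step' s| <= 2.
Proof.
rewrite /smooth_step' ger0_norm; last first.
  by rewrite mulr_ge0 ?mulr_ge0 ?pos_part_ge0 ?invr_ge0 ?exprn_ge0 ?ltW.
rewrite ler_pdivrMl ?exprn_gt0//.
have := pos_part_ge0 s; move: (pos_part s) => m m0; nra.
Qed.

End smooth_step.

Section bump.
Context {R : realType}.
Implicit Types k a b t : R.

(** A step up at [a] times a step down at [b], both of steepness [k]. For [k >= 0] it vanishes off
    the open interval, and it increases to the indicator of that interval as [k] grows. *)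
Definition bump k a b t : R := smooth_step (k * (t - a)) * smooth_step (k * (b - t)).
Definition bump' k a b t : R :=
  smooth_step (k * (t - a)) * (- k * smooth_step' (k * (b - t))) +
  smooth_step (k * (b - t)) * (k * smooth_step' (k * (t - a))).

Lemma is_derive_bump k a b t : is_derive t 1 (bump k a b) (bump' k a b t).
Proof.
have H c e : is_derive t 1 (fun t => smooth_step (c * t + e)) (c * smooth_step' (c * t + e)).
  have d1 : is_derive t 1 (fun t : R => c * t + e) (c * 1).
    have d0 := @is_deriveZ R R^o R^o (@id R) c t 1 1 (is_derive_id t 1).
    have := @is_deriveD R R^o R^o (fun t : R => c * t) (cst e) t 1 _ 0 d0 _.
    by rewrite addr0; apply; exact: is_derive_cst.
  rewrite mulr1 in d1.
  by have := @is_derive1_comp _ smooth_step (fun t => c * t + e) t _ _ (is_derive_smooth_step _) d1; rewrite mulrC.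
have d1 := H k (- (k * a)).
have d2 := H (- k) (k * b).
have := @is_deriveM R R^o (fun t => smooth_step (k * t - k * a)) (fun t => smooth_step (- k * t + k * b)) t 1 _ _ d1 d2.
have e1 x : k * x - k * a = k * (x - a) by rewrite mulrBr.
have e2 x : - k * x + k * b = k * (b - x) by rewrite mulrBr addrC mulNr.
congr (is_derive t 1 _ _).
  by apply/funext => x; rewrite /bump -e1 -e2.
by rewrite /bump' -e1 -e2.
Qed.

Lemma bump_continuous k a b : continuous (bump k a b).
Proof.
move=> t; apply/differentiable_continuous/derivable1_diffP.
by have [] := is_derive_bump k a b t.
Qed.

Lemma bump'_continuous k a b : continuous (bump' k a b).
Proof.
move=> t.
have c1 : k * (t - a) @[t --> t] --> k * (t - a).
  by apply: cvgMl_tmp; apply: cvgB; [exact: cvg_id|exact: cvg_cst].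
have c2 : k * (b - t) @[t --> t] --> k * (b - t).
  by apply: cvgMl_tmp; apply: cvgB; [exact: cvg_cst|exact: cvg_id].
apply: cvgD; apply: cvgM.
- by apply: cvg_comp c1 _; exact: smooth_step_continuous.
- by apply: cvgMl_tmp; apply: cvg_comp c2 _; exact: smooth_step'_continuous.
- by apply: cvg_comp c2 _; exact: smooth_step_continuous.
- by apply: cvgMl_tmp; apply: cvg_comp c1 _; exact: smooth_step'_continuous.
Qed.

Lemma bump_ge0 k a b t : 0 <= bump k a b t.
Proof. by rewrite mulr_ge0 ?smooth_step_ge0. Qed.

Lemma bump_le1 k a b t : bump k a b t <= 1.
Proof. by rewrite mulr_ile1 ?smooth_step_ge0 ?smooth_step_le1. Qed.

Lemma bump'_bounded k a b t : 0 <= k -> `|bump' k a b t| <= 4 * k.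
Proof.
move=> k0; rewrite (le_trans (ler_normD _ _))//.
have H x y : `|smooth_step x * (k * smooth_step' y)| <= k * 2.
  rewrite normrM ger0_norm ?smooth_step_ge0// normrM ger0_norm//.
  rewrite -[leRHS]mul1r ler_pM ?smooth_step_ge0 ?smooth_step_le1 ?mulr_ge0//.
  by rewrite ler_wpM2l// smooth_step'_bounded.
by rewrite mulNr mulrN normrN; have := H (k * (t - a)) (k * (b - t)); have := H (k * (b - t)) (k * (t - a)); lra.
Qed.

Lemma bump_eq0 k a b t : 0 <= k -> ~ (a < t < b) -> bump k a b t = 0.
Proof.
move=> k0 /negP; rewrite negb_and -!leNgt /bump => /orP[ta|bt].
  by rewrite smooth_step_le0 ?mul0r// mulr_ge0_le0// subr_le0.
by rewrite [X in _ * X]smooth_step_le0 ?mulr0// mulr_ge0_le0// subr_le0.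
Qed.

Lemma bump'_eq0 k a b t : 0 <= k -> ~ (a < t < b) -> bump' k a b t = 0.
Proof.
move=> k0 /negP; rewrite negb_and -!leNgt /bump' => /orP[ta|bt].
  have kta : k * (t - a) <= 0 by rewrite mulr_ge0_le0// subr_le0.
  by rewrite [smooth_step (k * (t - a))]smooth_step_le0// [smooth_step' (k * (t - a))]smooth_step'_le0// !(mul0r, mulr0) addr0.
have kbt : k * (b - t) <= 0 by rewrite mulr_ge0_le0// subr_le0.
by rewrite [smooth_step (k * (b - t))]smooth_step_le0// [smooth_step' (k * (b - t))]smooth_step'_le0// !(mul0r, mulr0) addr0.
Qed.

Lemma bump_cvg1 a b t : a < t < b -> bump k.+1%:R a b t @[k --> \oo] --> (1 : R).
Proof.
move=> /andP[at_ tb]; rewrite -[X in _ --> X](mulr1 1).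
by apply: cvgM; apply: smooth_step_cvg1; rewrite subr_gt0.
Qed.

End bump.

Section box_bump.
Context {R : realType} {n : nat}.
Local Notation E := 'rV[R]_n.
Implicit Types (k : R) (a b x : E) (i : 'I_n).

Definition box_bump k a b x : R :=
  \prod_(j < n) bump k (a ord0 j) (b ord0 j) (x ord0 j).
Definition box_bump' k a b i x : R :=
  (\prod_(j < n | j != i) bump k (a ord0 j) (b ord0 j) (x ord0 j)) *
  bump' k (a ord0 i) (b ord0 i) (x ord0 i).

Let bumps_continuous (P : pred 'I_n) k a b : continuous (fun x : E =>
  \prod_(j < n | P j) bump k (a ord0 j) (b ord0 j) (x ord0 j)).
Proof.
apply: continuous_big => [p|j _ x]; first exact: mul_continuous.
apply: (@continuous_comp _ _ _ (fun x : E => x ord0 j)).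
  exact: coord_continuous.
exact: bump_continuous.
Qed.

Lemma box_bump_continuous k a b : continuous (box_bump k a b).
Proof. exact: bumps_continuous. Qed.

Lemma box_bump'_continuous k a b i : continuous (box_bump' k a b i).
Proof.
move=> x; have c1 := @bumps_continuous (fun j => j != i) k a b x.
have c2 : {for x, continuous (fun y : E => bump' k (a ord0 i) (b ord0 i) (y ord0 i))}.
  apply: (@continuous_comp _ _ _ (fun x : E => x ord0 i)).
    exact: coord_continuous.
  exact: bump'_continuous.
exact: (cvgM c1 c2).
Qed.

Lemma is_derive_box_bump k a b i x :
  is_derive x (delta_mx ord0 i) (box_bump k a b) (box_bump' k a b i x).
Proof.
(* Along the [i]-th axis the other factors are constant, so the product behaves like a one-variable
   bump times [c]. *)
pose c := \prod_(j < n | j != i) bump k (a ord0 j) (b ord0 j) (x ord0 j).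
have d : is_derive x (delta_mx ord0 i)
    (fun y => c * bump k (a ord0 i) (b ord0 i) (y ord0 i)) (box_bump' k a b i x).
  apply: (@is_derive_along R R^o _ (fun y : E => y ord0 i)
    (fun t => c * bump k (a ord0 i) (b ord0 i) t) _ _ 1).
    by move=> h; rewrite !mxE !eqxx mulr1 [h *: 1]mulr1.
  exact: (@is_deriveZ R R^o R^o (bump k _ _) c _ 1 _ (is_derive_bump _ _ _ _)).
have [d1 d2] := d.
have bE y : box_bump k a b y =
    (\prod_(j < n | j != i) bump k (a ord0 j) (b ord0 j) (y ord0 j)) *
    bump k (a ord0 i) (b ord0 i) (y ord0 i).
  by rewrite /box_bump (bigD1 i)//= mulrC.
have E1 : (fun h : R => h^-1 *: ((box_bump k a b \o shift x) (h *: delta_mx ord0 i) - box_bump k a b x)) =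
  (fun h => h^-1 *: (((fun y : E => c * bump k (a ord0 i) (b ord0 i) (y ord0 i)) \o shift x)
     (h *: delta_mx ord0 i) - c * bump k (a ord0 i) (b ord0 i) (x ord0 i))).
  apply/funext => h /=; rewrite !bE -/c; congr (_ *: (_ * _ - _)).
  by apply: eq_bigr => j ji; rewrite !mxE (negbTE ji) andbF mulr0 add0r.
by split; rewrite /derivable /derive E1.
Qed.

Let bumps_ge0 (P : pred 'I_n) k a b x :
  0 <= \prod_(j < n | P j) bump k (a ord0 j) (b ord0 j) (x ord0 j).
Proof. by apply: prodr_ge0 => j _; exact: bump_ge0. Qed.

Let bumps_le1 (P : pred 'I_n) k a b x :
  \prod_(j < n | P j) bump k (a ord0 j) (b ord0 j) (x ord0 j) <= 1.
Proof. by apply: prodr_ile1 => j _; rewrite bump_ge0 bump_le1. Qed.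

Lemma box_bump_ge0 k a b x : 0 <= box_bump k a b x.
Proof. exact: bumps_ge0. Qed.

Lemma box_bump_le1 k a b x : box_bump k a b x <= 1.
Proof. exact: bumps_le1. Qed.

Lemma box_bump'_bounded k a b i x : 0 <= k -> `|box_bump' k a b i x| <= 4 * k.
Proof.
move=> k0; rewrite normrM ger0_norm ?bumps_ge0// -[leRHS]mul1r.
by rewrite ler_pM ?bumps_ge0 ?bumps_le1 ?bump'_bounded.
Qed.

Lemma box_bump_eq0 k a b x : 0 <= k -> ~ rV_box a b x -> box_bump k a b x = 0.
Proof.
move=> k0 /existsNP[j xj]; rewrite /box_bump (bigD1 j)//= bump_eq0 ?mul0r//.
Qed.

Lemma box_bump'_eq0 k a b i x : 0 <= k -> ~ rV_box a b x -> box_bump' k a b i x = 0.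
Proof.
move=> k0 /existsNP[j xj]; have [ij|ij] := eqVneq j i.
  by rewrite /box_bump' -ij bump'_eq0 ?mulr0.
by rewrite /box_bump' (bigD1 j)//= bump_eq0 ?mul0r.
Qed.

Lemma box_bump_cvg a b x :
  box_bump k.+1%:R a b x @[k --> \oo] --> (\1_(rV_box a b) x : R).
Proof.
rewrite indicE; have [xB|xB] := pselect (rV_box a b x); last first.
  rewrite memNset//; under eq_cvg do rewrite box_bump_eq0//.
  exact: cvg_cst.
rewrite mem_set//.
suff : box_bump k.+1%:R a b x @[k --> \oo] --> \prod_(j < n) (1 : R).
  by rewrite big1_eq.
apply: cvg_big; first exact: mul_continuous.
by move=> j _; apply: bump_cvg1; exact: xB.
Qed.

End box_bump.

(** * Test functions *)

Section test_function_theory.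
Context {R : realType} {n : nat}.
Local Notation E := 'rV[R]_n.
Implicit Types (u v : E -> R).

Lemma rV_ball0E (M : R) (x : E) : ball 0 M x <-> `|x| < M.
Proof. by rewrite -ball_normE /ball_ /= sub0r normrN. Qed.

Lemma bounded_of_support (g : E -> R) (M : R) : continuous g ->
  (forall x, ~ ball 0 M x -> g x = 0) -> exists C, forall x, `|g x| <= C.
Proof.
move=> cg g0.
have cK : compact [set x : E | `|x| <= M].
  apply: bounded_closed_compact.
    exists M; split; first exact: num_real.
    by move=> t Mt x /= xM; exact: le_trans xM (ltW Mt).
  apply: (@closed_comp _ _ _ [set y : R | y <= M]); last exact: closed_le.
  by move=> x _; exact: norm_continuous.
have cgK : compact (g @` [set x : E | `|x| <= M]).
  by apply: continuous_compact => //; exact: continuous_subspaceT.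
have /pinfty_ex_gt0[C C0 gC] := compact_bounded cgK.
exists C => x; have [xM|xM] := pselect (ball 0 M x).
  by apply: gC; exists x => //=; apply/ltW/rV_ball0E.
by rewrite g0// normr0 ltW.
Qed.

Lemma test_function_continuous u : test_function u -> continuous u.
Proof. by move=> [_ /(_ [::])]. Qed.

Lemma test_function_pderiv_continuous i u : test_function u -> continuous (pderiv i u).
Proof. by move=> [_ /(_ [:: i])]. Qed.

Lemma test_function_is_derive i u x : test_function u ->
  is_derive x (delta_mx ord0 i) u (pderiv i u x).
Proof. by move=> [/(_ [::] i x) d _ _]; exact: DeriveDef. Qed.

Lemma test_function_support u : test_function u ->
  exists M : R, (forall x, ~ ball 0 M x -> u x = 0) /\
    (forall i x, ~ ball 0 M x -> pderiv i u x = 0).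
Proof.
move=> [_ _ cS]; have /pinfty_ex_gt0[M M0 SM] := compact_bounded cS.
(* The bound on the support is a weak inequality and balls are open, hence the radius [M + 1]. *)
have H x : ~ ball 0 (M + 1) x -> ~ closure [set x | u x != 0] x.
  move=> xM xS; apply: xM; apply/rV_ball0E; apply: le_lt_trans (SM x xS) _.
  by rewrite ltrDl.
exists (M + 1); split.
  move=> x /H xS; apply/eqP/negPn/negP => ux.
  by apply: xS; exact: subset_closure.
move=> i x /H xS; rewrite /pderiv -(@derive_cst _ _ _ (0 : R) x (delta_mx ord0 i)).
apply: near_eq_derive.
have : nbhs x (~` closure [set x | u x != 0]).
  by apply: open_nbhs_nbhs; split => //; exact/closed_openC/closed_closure.
apply: filterS => y yS; apply/eqP/negPn/negP => uy.
by apply: yS; exact: subset_closure.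
Qed.

Lemma iter_pderiv_lin (s : seq 'I_n) (a b : R) u v :
  test_function u -> test_function v ->
  iter_pderiv s (fun x => a * u x + b * v x) =
  (fun x => a * iter_pderiv s u x + b * iter_pderiv s v x).
Proof.
move=> [du _ _] [dv _ _]; elim: s => [//|i s IH] /=; rewrite IH.
apply/funext => x; rewrite /pderiv.
have d1 : is_derive x (delta_mx ord0 i) (iter_pderiv s u) (pderiv i (iter_pderiv s u) x).
  exact: DeriveDef.
have d2 : is_derive x (delta_mx ord0 i) (iter_pderiv s v) (pderiv i (iter_pderiv s v) x).
  exact: DeriveDef.
have [_] := is_deriveD (@is_deriveZ R _ R^o _ a _ _ _ d1) (@is_deriveZ R _ R^o _ b _ _ _ d2).
exact.
Qed.

Lemma test_function_lin (a b : R) u v : test_function u -> test_function v ->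
  test_function (fun x => a * u x + b * v x).
Proof.
move=> tu tv; have [du cu su] := tu; have [dv cv sv] := tv; split.
- move=> s i x; rewrite iter_pderiv_lin//.
  by apply: derivableD; [apply: (@derivableZ R _ R^o)|apply: (@derivableZ R _ R^o)].
- move=> s x; rewrite iter_pderiv_lin//; have c1 := cu s x; have c2 := cv s x.
  exact: (cvgD (cvgMl_tmp c1) (cvgMl_tmp c2)).
- apply: (subclosed_compact _ (compactU su sv)); first exact: closed_closure.
  rewrite -closureU; apply: closureS => x /= h.
  have [ux|ux] := eqVneq (u x) 0; last by left.
  right; apply/negP => /eqP vx; move/eqP : h; apply; by rewrite ux vx !mulr0 addr0.
Qed.

Lemma classical_gradient_lin (a b : R) u v x : test_function u -> test_function v ->
  classical_gradient (fun x => a * u x + b * v x) x =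
  a *: classical_gradient u x + b *: classical_gradient v x.
Proof.
move=> tu tv; apply/rowP => i; rewrite !mxE.
exact: (congr1 (@^~ x) (iter_pderiv_lin [:: i] a b tu tv)).
Qed.

End test_function_theory.

(** * The space D^{1,2} *)

Section sqnorm_theory.
Context {R : realType} {n : nat}.
Local Notation E := 'rV[R]_n.
Implicit Types (v w : E).

Lemma sqnorm_ge0 v : 0 <= sqnorm v.
Proof. by apply: sumr_ge0 => i _; rewrite -expr2 sqr_ge0. Qed.

Lemma sqr_coord_le_sqnorm v i : (v ord0 i) ^+ 2 <= sqnorm v.
Proof.
rewrite /sqnorm /dotv (bigD1 i)//= -expr2 lerDl.
by apply: sumr_ge0 => j _; rewrite -expr2 sqr_ge0.
Qed.

Lemma dotvC v w : dotv v w = dotv w v.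
Proof. by apply: eq_bigr => i _; rewrite mulrC. Qed.

Lemma dotvDl u v w : dotv (u + v) w = dotv u w + dotv v w.
Proof. by rewrite /dotv -big_split; apply: eq_bigr => i _; rewrite mxE mulrDl. Qed.

Lemma dotvZl (a : R) v w : dotv (a *: v) w = a * dotv v w.
Proof. by rewrite /dotv mulr_sumr; apply: eq_bigr => i _; rewrite mxE mulrA. Qed.

Lemma dotvDr u v w : dotv w (u + v) = dotv w u + dotv w v.
Proof. by rewrite dotvC dotvDl !(dotvC w). Qed.

Lemma dotvZr (a : R) v w : dotv w (a *: v) = a * dotv w v.
Proof. by rewrite dotvC dotvZl dotvC. Qed.

Lemma dotvBr u v w : dotv w (u - v) = dotv w u - dotv w v.
Proof. by rewrite -scaleN1r dotvDr dotvZr mulN1r. Qed.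

Lemma dotvv0 : dotv (0 : E) 0 = 0.
Proof. by rewrite /dotv big1// => i _; rewrite mxE mul0r. Qed.

Lemma sqnorm_lin (a b : R) v w : sqnorm (a *: v + b *: w) =
  a ^+ 2 * sqnorm v + 2 * a * b * dotv v w + b ^+ 2 * sqnorm w.
Proof.
rewrite /sqnorm !(dotvDl, dotvDr, dotvZl, dotvZr) (dotvC w v); ring.
Qed.

Lemma sqnorm_lin_le (a b : R) v w : sqnorm (a *: v + b *: w) <=
  2 * a ^+ 2 * sqnorm v + 2 * b ^+ 2 * sqnorm w.
Proof.
have := sqnorm_ge0 (a *: v + (- b) *: w); rewrite !sqnorm_lin; nra.
Qed.

Lemma measurable_dotv d (T : measurableType d) (f g : T -> E) :
  measurable_fun setT f -> measurable_fun setT g ->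
  measurable_fun setT (fun x => dotv (f x) (g x)).
Proof.
move=> mf mg; apply: measurable_sum => i; apply: measurable_funM.
  by apply: (measurableT_comp (measurable_rV_coord i)).
by apply: (measurableT_comp (measurable_rV_coord i)).
Qed.

Lemma measurable_rV_lin d (T : measurableType d) (f g : T -> E) (a b : R) :
  measurable_fun setT f -> measurable_fun setT g ->
  measurable_fun setT (fun x => a *: f x + b *: g x).
Proof.
move=> mf mg; apply: measurable_to_rV => i.
under eq_fun do rewrite !mxE.
apply: measurable_funD; apply: measurable_funM => //.
  by apply: (measurableT_comp (measurable_rV_coord i)).
by apply: (measurableT_comp (measurable_rV_coord i)).
Qed.

End sqnorm_theory.

Section Lnorm_scale.
Context d (T : measurableType d) (R : realType) (mu : {measure set T -> \bar R}).

Lemma LnormZ_EFin (p a : R) (f : T -> R) : 0 < p -> measurable_fun setT f ->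
  ('N[mu]_(p%:E)[EFin \o (fun x => (a * f x)%R)] = `|a|%:E * 'N[mu]_(p%:E)[EFin \o f])%E.
Proof.
move=> p0 mf; rewrite unlock /=.
under eq_integral do rewrite normrM powRM// EFinM.
have mfp : measurable_fun setT (fun x => (`|f x| `^ p)%:E).
  apply/measurable_EFinP; apply: (measurableT_comp (@measurable_powR R p)).
  exact: measurableT_comp.
rewrite ge0_integralZl_EFin ?powR_ge0//.
rewrite poweRM ?lee_fin ?powR_ge0 ?integral_ge0//.
by rewrite poweR_EFin -powRrM divff ?gt_eqF// powRr1.
Qed.

End Lnorm_scale.

Section D12_theory.
Context {R : realType} {N : nat}.
Local Notation E := 'rV[R]_N.
Local Notation leb := (@rV_leb R N).
Local Notation p := (sobolev_exponent R N).
Hypothesis N3 : (3 <= N)%N.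
Implicit Types (u v : E -> R) (g h : E -> E).

Lemma sobolev_exponent_gt1 : 1 < p.
Proof.
rewrite /sobolev_exponent ltr_pdivlMr ?ltr0n ?subn_gt0//.
rewrite mul1r ltr_nat; apply: leq_ltn_trans (leq_subr 2 N) _.
by rewrite ltn_Pmull// (leq_trans _ N3).
Qed.

Lemma measurable_classical_gradient u : test_function u ->
  measurable_fun setT (classical_gradient u).
Proof.
move=> tu; apply: measurable_to_rV => i; under eq_fun do rewrite mxE.
by apply: measurable_rV_continuous; exact: test_function_pderiv_continuous.
Qed.

Lemma measurable_test_function u : test_function u -> measurable_fun setT u.
Proof. by move=> tu; apply: measurable_rV_continuous; exact: test_function_continuous. Qed.

(** Approximating sequences are combined. The L^{2*} error is controlled by Minkowski; the gradient
    error is an integral of squares without root, so the pointwise bound [sqnorm_lin_le] is used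
    there. *)
Lemma D12_gradient_lin (a b : R) u v g h :
  D12_gradient u g -> D12_gradient v h ->
  D12_gradient (fun x => a * u x + b * v x) (fun x => a *: g x + b *: h x).
Proof.
have p1 := sobolev_exponent_gt1; have p0 : 0 < p by apply: lt_trans p1.
move=> [mu_ mg [u_ [tu uu ug]]] [mv mh [v_ [tv vv vg]]]; split.
- by apply: measurable_funD; apply: measurable_funM.
- exact: measurable_rV_lin.
exists (fun n x => a * u_ n x + b * v_ n x); split.
- by move=> n; exact: test_function_lin.
- apply: (@squeeze_cvge _ _ _ _ (fun=> 0%E) _ (fun n =>
    `|a|%:E * 'N[leb]_(p%:E)[EFin \o (u_ n \- u)%R] +
    `|b|%:E * 'N[leb]_(p%:E)[EFin \o (v_ n \- v)%R])%E).
  + apply: nearW => n; rewrite Lnorm_ge0 /=.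
    have m1 : measurable_fun setT (u_ n \- u).
      by apply: measurable_funB => //; exact: measurable_test_function.
    have m2 : measurable_fun setT (v_ n \- v).
      by apply: measurable_funB => //; exact: measurable_test_function.
    rewrite -!LnormZ_EFin//.
    have := @minkowski_EFin _ _ _ leb (fun x => a * (u_ n \- u) x) (fun x => b * (v_ n \- v) x) p.
    move=> /(_ (measurable_funM (measurable_cst _) m1) (measurable_funM (measurable_cst _) m2) (ltW p1)).
    apply: le_trans; rewrite le_eqVlt; apply/orP; left; apply/eqP.
    by apply: eq_Lnorm => x /=; congr EFin; ring.
  + exact: cvg_cst.
  + rewrite -[X in _ --> X]adde0 -[X in _ --> (X + _)%E](mule0 `|a|%:E) -[X in _ --> (_ + X)%E](mule0 `|b|%:E).
    apply: cvgeD; first by rewrite !mule0.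
      exact: cvgeZl.
    exact: cvgeZl.
- have sq2_ge0 (t : R) : 0 <= 2 * t ^+ 2 by rewrite mulr_ge0 ?sqr_ge0.
  have msq (w : nat -> E -> R) (k : E -> E) n : test_function (w n) -> measurable_fun setT k ->
      measurable_fun setT (fun x => (sqnorm (classical_gradient (w n) x - k x))%:E).
    move=> tw mk; apply/measurable_EFinP.
    have H : measurable_fun setT (fun x => classical_gradient (w n) x - k x).
      have := measurable_rV_lin 1 (-1) (measurable_classical_gradient tw) mk.
      by under eq_fun do rewrite scale1r scaleN1r.
    exact: measurable_dotv.
  apply: (@squeeze_cvge _ _ _ _ (fun=> 0%E) _ (fun n =>
    (2 * a ^+ 2)%:E * \int[leb]_x (sqnorm (classical_gradient (u_ n) x - g x))%:E +
    (2 * b ^+ 2)%:E * \int[leb]_x (sqnorm (classical_gradient (v_ n) x - h x))%:E)%E).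
  + apply: nearW => n; apply/andP; split.
      by apply: integral_ge0 => x _; rewrite lee_fin sqnorm_ge0.
    rewrite -!ge0_integralZl_EFin//; try (by move=> x _; rewrite lee_fin sqnorm_ge0);
      try exact: sq2_ge0; try exact: msq.
    rewrite -ge0_integralD//; try (by move=> x _; rewrite -EFinM lee_fin; apply: mulr_ge0; [exact: sq2_ge0|exact: sqnorm_ge0]);
      try (by apply: measurable_funeM; exact: msq).
    apply: ge0_le_integral => //.
    * by move=> x _; rewrite lee_fin sqnorm_ge0.
    * apply: (msq (fun n x => a * u_ n x + b * v_ n x) (fun x => a *: g x + b *: h x)).
        exact: test_function_lin.
      exact: measurable_rV_lin.
    * by apply: emeasurable_funD; apply: measurable_funeM; exact: msq.
    * move=> x _; rewrite -!EFinM -EFinD lee_fin classical_gradient_lin//.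
      apply: le_trans (sqnorm_lin_le _ _ _ _); rewrite le_eqVlt; apply/orP; left; apply/eqP.
      congr sqnorm; rewrite !scalerBr opprD; by rewrite addrACA.
  + exact: cvg_cst.
  + have c1 := cvgeZl (y := (2 * a ^+ 2)%:E) isT ug.
    have c2 := cvgeZl (y := (2 * b ^+ 2)%:E) isT vg.
    rewrite !mule0 in c1 c2.
    have d0 : ((0 : \bar R) +? 0)%E by [].
    have := cvgeD d0 c1 c2; rewrite adde0; exact.
Qed.

Lemma test_gradient_L2 u : test_function u ->
  leb.-integrable setT (fun x => (sqnorm (classical_gradient u x))%:E).
Proof.
move=> tu; have [M [_ uM]] := test_function_support tu.
have c : continuous (fun x => sqnorm (classical_gradient u x)).
  have -> : (fun x => sqnorm (classical_gradient u x)) =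
      (fun x => \sum_(i < N) pderiv i u x * pderiv i u x).
    by apply/funext => x; apply: eq_bigr => i _; rewrite !mxE.
  apply: continuous_big => [q|i _ x]; first exact: add_continuous.
  have cx := @test_function_pderiv_continuous _ _ i u tu x.
  exact: (cvgM cx cx).
have z x : ~ ball 0 M x -> sqnorm (classical_gradient u x) = 0.
  by move=> xM; rewrite /sqnorm /dotv big1// => i _; rewrite !mxE uM// mul0r.
have [C uC] := bounded_of_support c z.
exact: (bounded_support_integrable (measurable_rV_continuous c) uC z).
Qed.

(** One approximating gradient at finite L^2 distance suffices, since it is itself continuous with
    compact support. *)
Lemma D12_gradient_L2 u g : D12_gradient u g ->
  leb.-integrable setT (fun x => (sqnorm (g x))%:E).
Proof.
move=> [mu_ mg [u_ [tu _ ug]]].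
have mB n : measurable_fun setT (fun x => classical_gradient (u_ n) x - g x).
  have := measurable_rV_lin 1 (-1) (measurable_classical_gradient (tu n)) mg.
  by under eq_fun do rewrite scale1r scaleN1r.
have [n un] : exists n, (\int[leb]_x (sqnorm (classical_gradient (u_ n) x - g x))%:E < 1)%E.
  have [m _ /(_ m (leqnn m))] : \forall n \near \oo,
      (\int[leb]_x (sqnorm (classical_gradient (u_ n) x - g x))%:E < 1)%E.
    exact: (ug _ (open_ereal_lt' (@lte01 R))).
  by exists m.
have i1 : leb.-integrable setT (fun x => (sqnorm (classical_gradient (u_ n) x - g x))%:E).
  apply/integrableP; split; first by apply/measurable_EFinP; exact: measurable_dotv.
  under eq_integral do rewrite gee0_abs ?lee_fin ?sqnorm_ge0//.
  exact: lt_trans un (ltry 1).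
apply: (@le_integrable _ _ _ leb _ measurableT _ (fun x =>
  (2%:E * (sqnorm (classical_gradient (u_ n) x))%:E +
   2%:E * (sqnorm (classical_gradient (u_ n) x - g x))%:E)%E)).
- by apply/measurable_EFinP; exact: measurable_dotv.
- move=> x _; rewrite -!EFinM -EFinD /= lee_fin ger0_norm ?sqnorm_ge0//.
  apply: le_trans (ler_norm _).
  have -> : sqnorm (g x) = sqnorm (1 *: classical_gradient (u_ n) x +
      (-1) *: (classical_gradient (u_ n) x - g x)).
    congr sqnorm; by rewrite scale1r scaleN1r opprB addrC subrK.
  apply: le_trans (sqnorm_lin_le _ _ _ _) _.
  by rewrite sqrrN expr1n !mulr1.
- by apply: integrableD => //; apply: integrableZl => //; exact: test_gradient_L2.
Qed.

(** Let [w_n] be test functions tending to 0 whose gradients tend to [h]. Since the derivative of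
    [w_n * phi] integrates to 0, the integral of [h_i * phi] is that of
    [(h_i - d_i w_n) * phi - w_n * d_i phi]. The first term is bounded by Young's inequality with a
    weight [e], the second by Hoelder with [q] conjugate to 2*. First [n] tends to infinity, then
    [e] to 0. Young fits because [A n] is an integral of squares. *)
Lemma D12_gradient0_coord (h : E -> E) (i : 'I_N) (k : R) (a b : E) :
  0 <= k -> D12_gradient (fun=> 0) h ->
  (\int[leb]_x (h x ord0 i * box_bump k a b x)%:E = 0)%E.
Proof.
move=> k0 D0; have p1 := sobolev_exponent_gt1; have p0 : 0 < p by apply: lt_trans p1.
have ih2 := D12_gradient_L2 D0.
have [_ mh [w_ [tw wu wg]]] := D0.
pose phi := box_bump k a b; pose dphi := box_bump' k a b i.
have [M BM] := rV_box_sub_ball a b.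
have phi0 x : ~ ball 0 M x -> phi x = 0.
  by move=> xM; apply: box_bump_eq0 => // /BM.
have dphi0 x : ~ ball 0 M x -> dphi x = 0.
  by move=> xM; apply: box_bump'_eq0 => // /BM.
have mphi : measurable_fun setT phi.
  exact: (measurable_rV_continuous (@box_bump_continuous _ _ _ _ _)).
have mdphi : measurable_fun setT dphi.
  exact: (measurable_rV_continuous (@box_bump'_continuous _ _ _ _ _ _)).
have iphi2 : leb.-integrable setT (EFin \o (fun x => phi x ^+ 2)).
  apply: (@bounded_support_integrable _ _ _ M 1).
  - exact: measurable_funX.
  - by move=> x; rewrite ger0_norm ?sqr_ge0// expr_le1 ?box_bump_ge0 ?box_bump_le1.
  - by move=> x /phi0 ->; rewrite expr0n.
have mhi : measurable_fun setT (fun x => h x ord0 i).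
  exact: (measurableT_comp (measurable_rV_coord i)).
have ihphi : leb.-integrable setT (fun x => (h x ord0 i * phi x)%:E).
  apply: (@le_integrable _ _ _ leb _ measurableT _ (fun x =>
    ((sqnorm (h x))%:E + (phi x ^+ 2)%:E)%E)).
  - by apply/measurable_EFinP; exact: measurable_funM.
  - move=> x _; rewrite -EFinD /= lee_fin [leRHS]ger0_norm ?addr_ge0 ?sqr_ge0 ?sqnorm_ge0//.
    have := sqr_coord_le_sqnorm (h x) i; rewrite ler_norml; move: (h x ord0 i) (phi x) (sqnorm _) => y z s ys.
    apply/andP; split; nra.
  - exact: integrableD.
pose q := (1 - p^-1)^-1.
have q0 : 0 < q by rewrite invr_gt0 subr_gt0 invf_lt1.
have pq : p^-1 + q^-1 = 1 by rewrite invrK addrC subrK.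
pose A n := (\int[leb]_x (sqnorm (classical_gradient (w_ n) x - h x))%:E)%E.
pose B n := ('N[leb]_(p%:E)[EFin \o (w_ n \- (fun=> 0))%R])%E.
pose K := (\int[leb]_x (phi x ^+ 2)%:E)%E.
pose Q := ('N[leb]_(q%:E)[EFin \o dphi])%E.
have Kfin : K \is a fin_num by exact: integrable_fin_num iphi2.
have Qfin : Q \is a fin_num.
  rewrite ge0_fin_numE ?Lnorm_ge0// /Q unlock; apply: poweR_lty.
  have idq : leb.-integrable setT (EFin \o (fun x => `|dphi x| `^ q)).
    apply: (@bounded_support_integrable _ _ _ M ((4 * k) `^ q)).
    - by apply: (measurableT_comp (@measurable_powR R q)); exact: measurableT_comp.
    - move=> x; rewrite ger0_norm ?powR_ge0//.
      apply: ge0_ler_powR; rewrite ?nnegrE ?mulr_ge0//; first exact: ltW.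
      exact: box_bump'_bounded.
    - by move=> x /dphi0 ->; rewrite normr0 powR0// gt_eqF.
  have := integrable_fin_num measurableT idq.
  rewrite ge0_fin_numE//; apply: integral_ge0 => x _; rewrite lee_fin powR_ge0//.
have key (e : R) n : 0 < e ->
    (`| \int[leb]_x (h x ord0 i * phi x)%:E | <= e^-1%:E * A n + e%:E * K + Q * B n)%E.
  move=> e0; pose w := w_ n; pose dw := pderiv i w.
  have cw : continuous w := test_function_continuous (tw n).
  have cdw : continuous dw := @test_function_pderiv_continuous _ _ i _ (tw n).
  have [L [w0 dw0]] := test_function_support (tw n).
  pose df x := w x * dphi x + phi x * dw x.
  have cdf : continuous df.
    move=> x; have c1 := cvgM (cw x) (@box_bump'_continuous _ _ k a b i x).
    have c2 := cvgM (@box_bump_continuous _ _ k a b x) (cdw x).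
    exact: (cvgD (c1 _) (c2 _)).
  have df0 x : ~ ball 0 L x -> df x = 0.
    by move=> xL; rewrite /df [w x]w0// [dw x]dw0// mul0r mulr0 addr0.
  have [C dfC] := bounded_of_support cdf df0.
  have idf : leb.-integrable setT (EFin \o df).
    exact: (bounded_support_integrable (measurable_rV_continuous cdf) dfC df0).
  have int0 : (\int[leb]_x (df x)%:E = 0)%E.
    apply: (@integral_partial0 _ _ i (fun x => w x * phi x) df L C) => //.
      by move=> x xL; rewrite [w x]w0// mul0r.
    move=> x; exact: (is_deriveM (test_function_is_derive i x (tw n)) (is_derive_box_bump k a b i x)).
  have mw : measurable_fun setT w := measurable_rV_continuous cw.
  have mS : measurable_fun setT (fun x => sqnorm (classical_gradient w x - h x)).
    have H := measurable_rV_lin 1 (-1) (measurable_classical_gradient (tw n)) mh.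
    have -> : (fun x => sqnorm (classical_gradient w x - h x)) =
        (fun x => sqnorm (1 *: classical_gradient w x + (-1) *: h x)).
      by apply/funext => x; rewrite scale1r scaleN1r.
    exact: measurable_dotv.
  have hB : (\int[leb]_x `|(w x * dphi x)%:E| <= Q * B n)%E.
    rewrite muleC; have := @hoelder _ _ _ leb w dphi p q mw mdphi p0 q0 pq.
    rewrite Lnorm1 => H; apply: (le_trans H); rewrite le_eqVlt; apply/orP; left; apply/eqP.
    by congr (_ * _)%E; apply: eq_Lnorm => x /=; rewrite subr0.
  (* Subtracting the vanishing integral of [df] is the integration by parts. *)
  have E0 : (\int[leb]_x (h x ord0 i * phi x)%:E =
      \int[leb]_x ((h x ord0 i * phi x)%:E - (df x)%:E))%E.
    by rewrite integralB// int0 sube0.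
  rewrite E0; apply: le_trans (le_abse_integral _ _ _) _ => //.
    by apply: emeasurable_funB; [have /measurable_int := ihphi|have /measurable_int := idf].
  apply: (@le_trans _ _ (\int[leb]_x (e^-1%:E * (sqnorm (classical_gradient w x - h x))%:E
      + e%:E * (phi x ^+ 2)%:E + `|(w x * dphi x)%:E|))%E).
    apply: ge0_le_integral => //.
    - by apply: measurableT_comp => //; apply: emeasurable_funB; [have /measurable_int := ihphi|have /measurable_int := idf].
    - apply: emeasurable_funD; last by apply: measurableT_comp => //; apply/measurable_EFinP; exact: measurable_funM.
      apply: emeasurable_funD; apply: measurable_funeM; apply/measurable_EFinP => //.
      exact: measurable_funX.
    - move=> x _; rewrite -EFinB /= -!EFinM -!EFinD lee_fin.
      have := sqr_coord_le_sqnorm (classical_gradient w x - h x) i.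
      rewrite !mxE -/(dw x); set y := dw x - _; move: (sqnorm _) => S yS.
      have -> : h x ord0 i * phi x - df x = - (y * phi x) - w x * dphi x.
        by rewrite /df /y; ring.
      apply: le_trans (ler_normB _ _) _; rewrite normrN lerD2r normrM.
      have : e^-1 * y ^+ 2 <= e^-1 * S by rewrite ler_wpM2l// invr_ge0 ltW.
      have : `|y| * `|phi x| <= e^-1 * (y ^+ 2 + (e * phi x) ^+ 2).
        rewrite ler_pdivlMl// -[y ^+ 2]real_normK ?num_real// -[(e * _) ^+ 2]real_normK ?num_real//.
        rewrite [`|e * _|]normrM (gtr0_norm e0); move: `|y| `|phi x| (normr_ge0 y) (normr_ge0 (phi x)) => s t s0 t0; nra.
      have -> : e^-1 * (y ^+ 2 + (e * phi x) ^+ 2) = e^-1 * y ^+ 2 + e * phi x ^+ 2.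
        by field; rewrite gt_eqF.
      lra.
  have m1 : measurable_fun setT (fun x => e^-1%:E * (sqnorm (classical_gradient w x - h x))%:E)%E.
    by apply: measurable_funeM; exact/measurable_EFinP.
  have mphi2 : measurable_fun setT (fun x => (phi x ^+ 2)%:E).
    by apply/measurable_EFinP; exact: measurable_funX.
  have m2 : measurable_fun setT (fun x => e%:E * (phi x ^+ 2)%:E)%E.
    exact: measurable_funeM.
  have m3 : measurable_fun setT (fun x => `|(w x * dphi x)%:E|)%E.
    by apply: measurableT_comp => //; apply/measurable_EFinP; exact: measurable_funM.
  have f1 x : (0 <= e^-1%:E * (sqnorm (classical_gradient w x - h x))%:E)%E.
    by rewrite -EFinM lee_fin mulr_ge0 ?sqnorm_ge0 ?invr_ge0 ?ltW.
  have f2 x : (0 <= e%:E * (phi x ^+ 2)%:E)%E.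
    by rewrite -EFinM lee_fin mulr_ge0 ?sqr_ge0 ?ltW.
  rewrite ge0_integralD//; try exact: emeasurable_funD;
    try (by move=> x _; exact: adde_ge0); try (by move=> x _; exact: abse_ge0).
  rewrite ge0_integralD//.
  rewrite !ge0_integralZl_EFin ?invr_ge0 ?(ltW e0)//; try exact/measurable_EFinP;
    try (by move=> x _; rewrite lee_fin ?sqr_ge0 ?sqnorm_ge0).
  exact: leeD.
have lim (e : R) : 0 < e -> (`| \int[leb]_x (h x ord0 i * phi x)%:E | <= e%:E * K)%E.
  move=> e0; have c1 := cvgeZl (y := e^-1%:E) isT wg.
  have c2 := cvgeZl Qfin wu.
  have d0 : ((0 : \bar R) +? e%:E * K)%E by [].
  have d1 : ((0 + e%:E * K : \bar R) +? 0)%E by rewrite fin_num_adde_defl.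
  rewrite !mule0 in c1 c2.
  have c : (fun n => e^-1%:E * A n + e%:E * K + Q * B n)%E @ \oo --> (0 + e%:E * K + 0)%E.
    apply: (cvgeD d1 _ c2); apply: (cvgeD d0 c1); exact: cvg_cst.
  rewrite -[leRHS]add0e -[leRHS]adde0 -(cvg_lim _ c)//.
  apply: lime_ge; first by apply/cvg_ex; eexists; exact: c.
  by apply: nearW => n; exact: key.
have := integrable_fin_num measurableT ihphi.
move: lim; rewrite -/phi; case: (\int[leb]_x _)%E => [r| |]//= lim _.
congr EFin; apply/eqP; rewrite -normr_le0 leNgt; apply/negP => r0.
have K0 : (0 <= K)%E by apply: integral_ge0 => x _; rewrite lee_fin sqr_ge0.
move: K0 lim; rewrite -(fineK Kfin) lee_fin; set c := fine K => c0.
(* With this [e], [e * c] is below half of [|r|], contradicting the bound; the added 1 covers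
   [c = 0]. *)
have e0 : 0 < `|r| / (2 * (c + 1)) by rewrite divr_gt0// mulr_gt0// ltr_wpDl.
move=> /(_ _ e0); rewrite -EFinM lee_fin mulrAC ler_pdivlMr; last by rewrite mulr_gt0// ltr_wpDl.
by rewrite ler_pM2l//; lra.
Qed.

End D12_theory.

(** * Uniqueness and linearity of the weak gradient *)

Section weak_gradient.
Context {R : realType} {N : nat}.
Local Notation E := 'rV[R]_N.
Local Notation leb := (@rV_leb R N).
Hypothesis N3 : (3 <= N)%N.
Implicit Types (u v : E -> R) (g h : E -> E).

Lemma D12_gradient0 h : D12_gradient (fun=> 0) h -> {ae leb, forall x, h x = 0}.
Proof.
move=> D0; have [_ mh _] := D0; have ih2 := D12_gradient_L2 D0.
have mhi i : measurable_fun setT (fun x => h x ord0 i).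
  exact: (measurableT_comp (measurable_rV_coord i)).
have H i : {ae leb, forall x, h x ord0 i = 0}.
  (* This is the dominating function for letting the bumps tend to the indicator of the box. It is
     integrable because [|h_i|] is at most [|h|^2 + 1] and boxes have finite measure. *)
  have ihB a b : leb.-integrable setT
      (fun x => (`|h x ord0 i| * \1_(rV_box a b) x)%:E).
    have i1 : leb.-integrable setT (EFin \o (\1_(rV_box a b) : E -> R)).
      have [M BM] := rV_box_sub_ball a b.
      apply: (@bounded_support_integrable _ _ _ M 1).
      - by apply: measurable_indic; exact: measurable_rV_box.
      - by move=> x; rewrite indicE; case: (_ \in _); rewrite ?normr1 ?normr0.
      - by move=> x xM; rewrite indicE memNset// => /BM.
    apply: (@le_integrable _ _ _ leb _ measurableT _ (fun x =>
      ((sqnorm (h x))%:E + (\1_(rV_box a b) x)%:E)%E)).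
    - apply/measurable_EFinP; apply: measurable_funM; first exact: measurableT_comp.
      by apply: measurable_indic; exact: measurable_rV_box.
    - move=> x _; rewrite -EFinD /= lee_fin [leLHS]ger0_norm ?mulr_ge0//.
      rewrite [leRHS]ger0_norm ?addr_ge0 ?sqnorm_ge0//.
      have := sqr_coord_le_sqnorm (h x) i; rewrite -[_ ^+ 2]real_normK ?num_real//.
      have := normr_ge0 (h x ord0 i); move: `|_| (sqnorm _) => y s y0 ys.
      have := sqr_ge0 (y - 1); have := sqr_ge0 y; rewrite indicE.
      by case: (_ \in _) => /=; rewrite ?mulr1n ?mulr0n ?mulr1 ?mulr0 ?addr0; nra.
    - exact: integrableD.
  have patchE a b : (EFin \o (fun x => h x ord0 i)) \_ (rV_box a b) =
      (fun x => (h x ord0 i * \1_(rV_box a b) x)%:E).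
    apply/funext => x; rewrite patchE indicE; case: (x \in _) => /=.
      by rewrite mulr1.
    by rewrite mulr0.
  have mB a b : measurable_fun setT (fun x => (h x ord0 i * \1_(rV_box a b) x)%:E).
    apply/measurable_EFinP; apply: measurable_funM => //.
    by apply: measurable_indic; exact: measurable_rV_box.
  apply: rV_ae_eq0 => // a b.
    apply/(integrable_mkcond _ (measurable_rV_box a b)); rewrite patchE.
    apply: le_integrable (ihB a b) => // x _ /=.
    by rewrite lee_fin !normrM normr_id.
  rewrite integral_mkcond patchE.
  have mf k : measurable_fun setT (fun x => (h x ord0 i * box_bump k.+1%:R a b x)%:E).
    apply/measurable_EFinP; apply: measurable_funM => //.
    exact: (measurable_rV_continuous (@box_bump_continuous _ _ _ _ _)).
  have cf : {ae leb, forall x, setT x ->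
      (h x ord0 i * box_bump k.+1%:R a b x)%:E @[k --> \oo] -->
      (h x ord0 i * \1_(rV_box a b) x)%:E}.
    apply: aeW => x _; apply: cvg_EFin; first exact: nearW.
    by apply: cvgMl_tmp; exact: box_bump_cvg.
  have df : {ae leb, forall x k, setT x ->
      (`|(h x ord0 i * box_bump k.+1%:R a b x)%:E| <= (`|h x ord0 i| * \1_(rV_box a b) x)%:E)%E}.
    apply: aeW => x k _; rewrite /= lee_fin normrM ler_wpM2l// ger0_norm ?box_bump_ge0//.
    rewrite indicE; have [xB|xB] := pselect (rV_box a b x).
      by rewrite mem_set// box_bump_le1.
    by rewrite memNset// box_bump_eq0.
  have [_ _ c] := dominated_convergence measurableT mf (mB a b) cf (ihB a b) df.
  rewrite -(cvg_lim _ c)//.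
  apply: lim_near_cst => //; apply: nearW => k.
  exact: D12_gradient0_coord.
have : {ae leb, forall x, forall i, h x ord0 i = 0} by exact: filter_forall.
by apply: filterS => x hx; apply/rowP => i; rewrite mxE.
Qed.

Lemma D12_gradient_unique u g h : D12_gradient u g -> D12_gradient u h ->
  {ae leb, forall x, g x = h x}.
Proof.
move=> ug uh; have := D12_gradient_lin N3 1 (-1) ug uh.
have -> : (fun x => 1 * u x + -1 * u x) = fun=> 0.
  by apply/funext => x; rewrite mul1r mulN1r subrr.
move/D12_gradient0; apply: filterS => x.
by rewrite scale1r scaleN1r => /eqP; rewrite subr_eq0 => /eqP.
Qed.

Lemma grad_spec u : D12 u -> D12_gradient u (grad u).
Proof. by move=> [g ug]; exact: (xgetPex (fun=> 0) (ex_intro _ g ug)). Qed.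

Lemma measurable_grad u : D12 u -> measurable_fun setT (grad u).
Proof. by move=> /grad_spec[]. Qed.

Lemma D12_lin (a b : R) u v : D12 u -> D12 v -> D12 (fun x => a * u x + b * v x).
Proof. by move=> /grad_spec Du /grad_spec Dv; eexists; exact: (D12_gradient_lin N3 a b Du Dv). Qed.

(** [grad] picks a representative separately for each function, so uniqueness of the weak gradient
    gives the identity a.e. *)
Lemma grad_lin (a b : R) u v : D12 u -> D12 v ->
  {ae leb, forall x, grad (fun x => a * u x + b * v x) x = a *: grad u x + b *: grad v x}.
Proof.
move=> Du Dv; apply: (D12_gradient_unique (grad_spec (D12_lin a b Du Dv))).
exact: (D12_gradient_lin N3 a b (grad_spec Du) (grad_spec Dv)).
Qed.

(** The condition on the coefficients covers all uses at once: the zero function, and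
    [(1 - t) * phi + (t * l) * psi]. *)
Lemma spaceA_lin (a b : R) u v : `|a| + `|b| <= 1 -> spaceA u -> spaceA v ->
  spaceA (fun x => a * u x + b * v x).
Proof.
move=> ab [Du lu gu] [Dv lv gv]; split; first exact: D12_lin.
  have /pinfty_ex_gt0[k k0 ku] := lu; have /pinfty_ex_gt0[l l0 lv'] := lv.
  rewrite /lipschitz_on; near=> M; move=> /= [x y] _ /=.
  suff : `|a * u x + b * v x - (a * u y + b * v y)| <= M * `|x - y| by [].
  have -> : a * u x + b * v x - (a * u y + b * v y) = a * (u x - u y) + b * (v x - v y).
    by ring.
  apply: le_trans (ler_normD _ _) _; rewrite !normrM.
  have kxy : `|u x - u y| <= k * `|x - y| by exact: (ku (x, y)).
  have lxy : `|v x - v y| <= l * `|x - y| by exact: (lv' (x, y)).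
  have : `|a| * `|u x - u y| <= `|a| * (k * `|x - y|) by rewrite ler_wpM2l.
  have : `|b| * `|v x - v y| <= `|b| * (l * `|x - y|) by rewrite ler_wpM2l.
  have : (`|a| * k + `|b| * l) * `|x - y| <= M * `|x - y|.
    by rewrite ler_wpM2r//; near: M; exact: nbhs_pinfty_ge.
  lra.
have := grad_lin a b Du Dv; move: gu gv; apply: filterS3 => x gu gv ->.
rewrite sqnorm_lin.
(* Nonnegativity of the squared lengths of sum and difference bounds the scalar product by 1, which
   replaces Cauchy-Schwarz. *)
have := sqnorm_ge0 (1 *: grad u x + 1 *: grad v x); have := sqnorm_ge0 (1 *: grad u x + (-1) *: grad v x).
rewrite !sqnorm_lin => d1 d2.
have d : `|dotv (grad u x) (grad v x)| <= 1 by rewrite ler_norml; apply/andP; split; lra.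
have : 2 * a * b * dotv (grad u x) (grad v x) <= 2 * `|a| * `|b|.
  apply: le_trans (ler_norm _) _; rewrite !normrM gtr0_norm// -[leRHS]mulr1.
  by rewrite ler_wpM2l// !mulr_ge0.
have : a ^+ 2 * sqnorm (grad u x) <= `|a| ^+ 2.
  by rewrite real_normK ?num_real// -[leRHS]mulr1 ler_wpM2l ?sqr_ge0.
have : b ^+ 2 * sqnorm (grad v x) <= `|b| ^+ 2.
  by rewrite real_normK ?num_real// -[leRHS]mulr1 ler_wpM2l ?sqr_ge0.
have : (`|a| + `|b|) ^+ 2 <= 1 by rewrite expr_le1// addr_ge0.
rewrite sqrrD mulr2n; lra.
Unshelve. all: by end_near. Qed.

Variable rho : (E -> R) -> R.
Hypothesis rhoA : dualA rho.

Lemma dualA_lin (a b : R) u v : spaceA u -> spaceA v ->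
  rho (fun x => a * u x + b * v x) = a * rho u + b * rho v.
Proof.
move=> Au Av; have [lin _] := rhoA.
have sZ (c : R) w : spaceA w -> spanA (c *: w) by move=> Aw; exists c, w.
have s0 : spanA (0 : E -> R).
  by exists 0, u; split => //; rewrite scale0r.
have r0 : rho (0 : E -> R) = 0.
  have := lin 1 0 0 s0 s0; rewrite scale1r addr0 mul1r => /eqP.
  by rewrite -subr_eq0 opprD addrA subrr sub0r oppr_eq0 => /eqP.
have s1 (w : E -> R) : spaceA w -> spanA w.
  by move=> Aw; rewrite -(scale1r w); exact: sZ.
have rZ (c : R) w : spaceA w -> rho (c *: w) = c * rho w.
  by move=> Aw; have := lin c w 0 (s1 _ Aw) s0; rewrite addr0 r0 addr0.
by have := lin a u (b *: v) (s1 _ Au) (sZ _ _ _ Av); rewrite rZ.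
Qed.

End weak_gradient.

(** * Minimizers *)

Section minimizer_theory.
Context {R : realType} {N : nat} (L : R -> R).
Variables (rho : ('rV[R]_N -> R) -> R) (phi : 'rV[R]_N -> R).
Local Notation E := 'rV[R]_N.
Local Notation leb := (@rV_leb R N).
Hypotheses (N3 : (3 <= N)%N) (LBI : born_infeld L) (rhoA : dualA rho)
  (phimin : minimizer L rho phi).

Definition bi_integral (v : E -> R) : \bar R :=
  (\int[leb]_x lagr L (2^-1 * sqnorm (grad v x)))%E.
Local Notation J := bi_integral.

Let Aphi : spaceA phi. Proof. by case: phimin. Qed.

Let m_sqnorm_grad (v : E -> R) : spaceA v -> measurable_fun setT (fun x => sqnorm (grad v x)).
Proof. by move=> [/measurable_grad mv _ _]; exact: measurable_dotv. Qed.

Let half_sqnorm_ge0 (g : E) : 0 <= 2^-1 * sqnorm g.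
Proof. by rewrite mulr_ge0 ?invr_ge0 ?sqnorm_ge0. Qed.

Lemma bi_integral_ge0 (v : E -> R) : (0 <= J v)%E.
Proof. by apply: integral_ge0 => x _; exact: (lagr_ge0 LBI). Qed.

Lemma eq_bi_integral (v : E -> R) (f : E -> R) : spaceA v -> measurable_fun setT f ->
  (forall x, 0 <= f x) -> {ae leb, forall x, 2^-1 * sqnorm (grad v x) = f x} ->
  J v = (\int[leb]_x lagr L (f x))%E.
Proof.
move=> Av mf f0 vf; apply: ge0_ae_eq_integral => //.
- by apply: (measurable_lagr LBI) => //; apply: measurable_funM => //; exact: m_sqnorm_grad.
- exact: (measurable_lagr LBI).
- by move=> x _; exact: (lagr_ge0 LBI).
- by move=> x _; exact: (lagr_ge0 LBI).
- by apply: filterS vf => x vfx _; rewrite vfx.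
Qed.

Lemma bi_integral_minimizer_lty : (J phi < +oo)%E.
Proof.
(* The competitor is the zero function, of energy 0, written as a combination so that the linearity
   lemmas apply. *)
have ab : `|0 : R| + `|0 : R| <= 1 by rewrite normr0 addr0.
have A0 := spaceA_lin N3 ab Aphi Aphi.
have := (phimin.2 _ A0); rewrite /bi_energy -/(J _) -/(J _).
rewrite (dualA_lin rhoA _ _ Aphi Aphi) !mul0r addr0 sube0.
have -> : J (fun x => 0 * phi x + 0 * phi x) = 0%E.
  rewrite (@eq_bi_integral _ (cst 0))//.
    apply: integral0_eq => x _; rewrite /lagr invr_gt0 ltr0n /= (bi_L0 LBI)//.
  have [Dphi _ _] := Aphi; have := grad_lin N3 0 0 Dphi Dphi.
  apply: filterS => x ->; rewrite !scale0r addr0 /sqnorm dotvv0 mulr0//.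
have := bi_integral_ge0 phi; case: (J phi) => // r _ _; exact: ltry.
Qed.

Let Jphi_fin : J phi \is a fin_num.
Proof. by rewrite ge0_fin_numE ?bi_integral_ge0// bi_integral_minimizer_lty. Qed.

Lemma minimizer_sqnorm_lt1 : {ae leb, forall x, sqnorm (grad phi x) < 1}.
Proof.
apply: (lagr_int_ae LBI); [|exact: m_sqnorm_grad|exact: bi_integral_minimizer_lty].
by move=> x; exact: sqnorm_ge0.
Qed.

Variable psi : E -> R.
Hypothesis Apsi : spaceA psi.

Let a x := sqnorm (grad phi x).
Let c x := sqnorm (grad psi x).
Let e x := dotv (grad phi x) (grad psi x).

Let ma : measurable_fun setT a. Proof. exact: m_sqnorm_grad. Qed.
Let mc : measurable_fun setT c. Proof. exact: m_sqnorm_grad. Qed.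
Let me : measurable_fun setT e.
Proof.
have [Dphi _ _] := Aphi; have [Dpsi _ _] := Apsi.
by apply: measurable_dotv; exact: measurable_grad.
Qed.

(* Scaling by l < 1 keeps |grad (l psi)| away from 1, so the energy of l psi is finite. *)
Lemma scaled_integral_lty (l : R) : 0 <= l < 1 ->
  (\int[leb]_x lagr L (2^-1 * (l ^+ 2 * c x)) < +oo)%E.
Proof.
(* [K] is [b] at the largest argument that can occur a.e. The tangent inequality towards 0 gives
   [L s <= b s * s <= K * s], so the energy is controlled by the L^2 norm of the gradient. *)
move=> l01; pose K := dom_derive L (2^-1 * l ^+ 2).
have lsq : 0 <= 2^-1 * l ^+ 2 < 2^-1 by move: l01 => /andP[l0 l1]; apply/andP; split; nra.
have K0 : 0 <= K by move: lsq => /andP[q0 q1]; exact: (bi_b_ge0 LBI).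
have [Dpsi _ cpsi] := Apsi; have ic := D12_gradient_L2 (grad_spec Dpsi).
have fin := integrable_fin_num measurableT ic.
have c0 x : 0 <= c x := sqnorm_ge0 _.
have s0 x : 0 <= 2^-1 * (l ^+ 2 * c x) by rewrite mulr_ge0 ?invr_ge0// mulr_ge0 ?sqr_ge0.
apply: (@le_lt_trans _ _ (\int[leb]_x (K%:E * (c x)%:E))%E); last first.
  rewrite ge0_integralZl_EFin//; try exact/measurable_EFinP;
    try (by move=> x _; rewrite lee_fin).
  by rewrite -(fineK fin) -EFinM ltry.
apply: ae_ge0_le_integral => //.
- by move=> x _; exact: (lagr_ge0 LBI).
- by apply: (measurable_lagr LBI) => //; do 2 apply: measurable_funM => //.
- by move=> x _; rewrite -EFinM lee_fin mulr_ge0.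
- by apply: measurable_funeM; exact/measurable_EFinP.
- apply: filterS cpsi => x cx _; rewrite -/(c x) in cx.
  have slt : 2^-1 * (l ^+ 2 * c x) <= 2^-1 * l ^+ 2.
    by rewrite ler_wpM2l// -[leRHS]mulr1 ler_wpM2l ?sqr_ge0.
  have s1 : 2^-1 * (l ^+ 2 * c x) < 2^-1 by move: lsq => /andP[_]; exact: le_lt_trans.
  rewrite /lagr s1 -EFinM lee_fin.
  have sd : 0 <= 2^-1 * (l ^+ 2 * c x) < 2^-1 by rewrite s0.
  have zd : 0 <= (0 : R) < 2^-1 by rewrite lexx invr_gt0 ltr0n.
  have := bi_tangent LBI sd zd; rewrite (bi_L0 LBI) !sub0r => H.
  have H2 := bi_b_nondecreasing LBI (s0 x) slt (proj2 (andP lsq)).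
  have b0 := bi_b_ge0 LBI (s0 x) s1.
  apply: (@le_trans _ _ (K * (2^-1 * (l ^+ 2 * c x)))).
    apply: (@le_trans _ _ (dom_derive L (2^-1 * (l ^+ 2 * c x)) * (2^-1 * (l ^+ 2 * c x)))); first lra.
    by rewrite ler_wpM2r.
  rewrite ler_wpM2l//; have := c0 x; move: l01 => /andP[l0 l1]; nra.
Qed.

Lemma minimizer_variation (l : R) : 0 <= l < 1 ->
  leb.-integrable setT (fun x => lagr_b L (2^-1 * a x) * (a x - l * e x)%:E)%E /\
  (\int[leb]_x (lagr_b L (2^-1 * a x) * (a x - l * e x)%:E) <= (rho phi - l * rho psi)%:E)%E.
Proof.
move=> l01; have [Dphi _ _] := Aphi; have [Dpsi _ _] := Apsi.
have sE (t : R) x : 2^-1 * a x - t * (a x - l * e x) +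
    t ^+ 2 / 2 * (a x - 2 * (l * e x) + l ^+ 2 * c x) =
    2^-1 * sqnorm ((1 - t) *: grad phi x + (t * l) *: grad psi x).
  by rewrite sqnorm_lin -/(a x) -/(c x) -/(e x); field.
apply: (@bi_variation _ _ _ leb L LBI a (fun x => l ^+ 2 * c x) (fun x => l * e x)) => //.
- exact: measurable_funM.
- exact: measurable_funM.
- by move=> x; exact: sqnorm_ge0.
- by move=> x; rewrite mulr_ge0 ?sqr_ge0 ?sqnorm_ge0.
- move=> x; have := sqnorm_ge0 (1 *: grad phi x + (- l) *: grad psi x).
  rewrite sqnorm_lin -/(a x) -/(c x) -/(e x); lra.
- by move=> t x; rewrite sE.
- exact: bi_integral_minimizer_lty.
- exact: scaled_integral_lty.
move=> t t01.
have ab : `|1 - t| + `|t * l| <= 1.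
  move: l01 t01 => /andP[l0 l1] /andP[t0 t1].
  by rewrite !ger0_norm ?mulr_ge0 ?subr_ge0 ?(ltW t0) ?(ltW t1)//; nra.
have Av := spaceA_lin N3 ab Aphi Apsi.
have := phimin.2 _ Av; rewrite /bi_energy -/(J _) -/(J _) (dualA_lin rhoA _ _ Aphi Apsi).
rewrite (@eq_bi_integral (fun x => (1 - t) * phi x + t * l * psi x)
  (fun x => 2^-1 * a x - t * (a x - l * e x) +
    t ^+ 2 / 2 * (a x - 2 * (l * e x) + l ^+ 2 * c x)))//; last 3 first.
- rewrite (funext (sE t)); apply: measurable_funM => //; apply: measurable_dotv;
    by apply: measurable_rV_lin; exact: measurable_grad.
- by move=> x; rewrite sE.
- by have := grad_lin N3 (1 - t) (t * l) Dphi Dpsi; apply: filterS => x ->; rewrite sE.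
rewrite -[X in _ -> (X <= _)%E]/(J phi) -(fineK Jphi_fin).
set Jv := (\int[leb]_x _)%E.
have : (0 <= Jv)%E by apply: integral_ge0 => x _; apply: (lagr_ge0 LBI); rewrite sE.
(* If [v_t] has infinite energy the inequality is trivial, so only the real case needs
   minimality. *)
case: Jv => [j| |]//= _; last by move=> _; rewrite addye ?leey.
rewrite -!EFinB -EFinD !lee_fin; lra.
Qed.

End minimizer_theory.

Lemma affine_le0 (R : realType) (x y : R) :
  (forall l, 0 <= l < 1 -> (1 - l) * x + l * y <= 0) -> y <= 0.
Proof.
move=> H; rewrite leNgt; apply/negP => y0.
have x0 : x <= 0 by have := H 0; rewrite lexx ltr01 => /(_ isT); lra.
have d0 : 0 < y - x by lra.
(* The parameter at which the affine function takes the value [y / 2], positive if [y] is. *)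
pose l := (y / 2 - x) / (y - x).
have l1 : l < 1 by rewrite ltr_pdivrMr//; lra.
have l0 : 0 <= l by rewrite divr_ge0//; lra.
have := H l; rewrite l0 l1 => /(_ isT).
have -> : (1 - l) * x + l * y = x + l * (y - x) by ring.
by rewrite divfK ?gt_eqF//; lra.
Qed.

Theorem lemma3p1 (R : realType) (N : nat) (L : R -> R)
    (rho : ('rV[R]_N -> R) -> R) (phi0 : 'rV[R]_N -> R) :
  (3 <= N)%N ->
  born_infeld L ->
  dualA rho ->
  minimizer L rho phi0 ->
  [/\ exists delta : nat -> R,
        [/\ decreasing_seq delta,
            forall n, 0 < delta n,
            delta n @[n --> \oo] --> 0,
            \bigcap_n Gc phi0 (delta n) = Gc0 phi0 &
            (@rV_leb R N).-negligible (Gc0 phi0)],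
      (@rV_leb R N).-integrable setT
        (fun x => lagr_b L (2^-1 * sqnorm (grad phi0 x))
                  * (sqnorm (grad phi0 x))%:E)%E &
      forall psi : 'rV[R]_N -> R, spaceA psi ->
        (@rV_leb R N).-integrable setT
          (fun x => lagr_b L (2^-1 * sqnorm (grad phi0 x))
                    * (dotv (grad phi0 x) (grad phi0 x - grad psi x))%:E)%E /\
        (\int[@rV_leb R N]_x (lagr_b L (2^-1 * sqnorm (grad phi0 x))
           * (dotv (grad phi0 x) (grad phi0 x - grad psi x))%:E)
         <= (rho (phi0 - psi))%:E)%E].
Proof.
move=> N3 LBI rhoA phimin; have [Aphi _] := phimin; have [Dphi _ _] := Aphi.
pose a x := sqnorm (grad phi0 x).
have l0 : 0 <= (0 : R) < 1 by rewrite lexx ltr01.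
have a_lt1 := minimizer_sqnorm_lt1 N3 LBI rhoA phimin.
have F0E (psi : 'rV[R]_N -> R) : (fun x => lagr_b L (2^-1 * sqnorm (grad phi0 x))
      * (sqnorm (grad phi0 x) - 0 * dotv (grad phi0 x) (grad psi x))%:E)%E =
    (fun x => lagr_b L (2^-1 * sqnorm (grad phi0 x)) * (sqnorm (grad phi0 x))%:E)%E.
  by apply/funext => x; rewrite mul0r subr0.
(* For [l = 0] the competitor [l psi] is the zero function whatever [psi] is, so [phi0] can fill the
   slot. *)
have i0 : (@rV_leb R N).-integrable setT
    (fun x => lagr_b L (2^-1 * sqnorm (grad phi0 x)) * (sqnorm (grad phi0 x))%:E)%E.
  by have [] := minimizer_variation N3 LBI rhoA phimin Aphi l0; rewrite F0E.
split => //.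
  exists harmonic; split.
  - by move=> m n; rewrite lef_pV2 ?posrE// ler_nat ltnS.
  - by move=> n; rewrite invr_gt0.
  - exact: cvg_harmonic.
  - apply/seteqP; split => x.
      move=> H; apply/eqP; rewrite eq_le; have /andP[_ ->] := H 0 Logic.I.
      rewrite /= -[leRHS]subr0.
      have c : sqnorm (grad phi0 x) + harmonic n @[n --> \oo] --> sqnorm (grad phi0 x) + 0.
        by apply: cvgD; [exact: cvg_cst|exact: cvg_harmonic].
      rewrite subr0 -[leRHS]addr0 -(cvg_lim _ c)//.
      apply: limr_ge; first by apply/cvg_ex; eexists; exact: c.
      by apply: nearW => n; have /andP[] := H n Logic.I; rewrite lerBlDr.
    move=> x1 n _; have E1 : sqnorm (grad phi0 x) = 1 by exact: x1.
    by rewrite /Gc /= E1 lexx andbT lerBlDr lerDl invr_ge0.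
  - apply: negligibleS a_lt1 => x x1 /=.
    have -> : sqnorm (grad phi0 x) = 1 by exact: x1.
    by rewrite ltxx.
move=> psi Apsi; have [Dpsi _ _] := Apsi.
pose F (l : R) x := (lagr_b L (2^-1 * a x) * (a x - l * dotv (grad phi0 x) (grad psi x))%:E)%E.
have Fl l : 0 <= l < 1 -> (@rV_leb R N).-integrable setT (F l) /\
    (\int[@rV_leb R N]_x F l x <= (rho phi0 - l * rho psi)%:E)%E.
  exact: (minimizer_variation N3 LBI rhoA phimin Apsi).
set G := (fun x => (_ * (dotv _ (_ - _))%:E)%E).
have mG : measurable_fun setT G.
  apply: emeasurable_funM.
    apply: (measurable_lagr_b LBI); first by move=> x; rewrite mulr_ge0 ?invr_ge0 ?sqnorm_ge0.
    by apply: measurable_funM => //; apply: measurable_dotv; exact: measurable_grad.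
  apply/measurable_EFinP; apply: measurable_dotv; first exact: measurable_grad.
  have := measurable_rV_lin 1 (-1) (measurable_grad Dphi) (measurable_grad Dpsi).
  by under eq_fun do rewrite scale1r scaleN1r.
have GE x : G x = (lagr_b L (2^-1 * a x) * (a x - dotv (grad phi0 x) (grad psi x))%:E)%E.
  by rewrite /G dotvBr.
have lagr_b_fin x : a x < 1 -> exists b, lagr_b L (2^-1 * a x) = b%:E.
  by move=> ax; rewrite /lagr_b ifT; [eexists|lra].
have F0 : F 0 = (fun x => lagr_b L (2^-1 * sqnorm (grad phi0 x)) * (sqnorm (grad phi0 x))%:E)%E.
  exact: F0E.
have h01 : 0 <= (2^-1 : R) < 1 by lra.
have [ih _] := Fl _ h01.
(* Extrapolation: [F l] is affine in [l], so its value at 1 is [2 F(1/2) - F(0)], two cases already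
   known to be integrable. The identity holds where [a x < 1], since there [lagr_b] is finite. *)
have iG : (@rV_leb R N).-integrable setT G.
  apply: (@ae_eq_integrable _ _ _ (@rV_leb R N) (fun x => 2%:E * F 2^-1%R x - F 0%R x)%E G mG).
    apply: filterS a_lt1 => x /lagr_b_fin [b bE] _.
    by rewrite GE /F bE -!EFinM -EFinB; congr EFin; field.
  apply: integrableB => //; last by rewrite F0.
  exact: integrableZl.
split => //.
have /fineK E0 := integrable_fin_num measurableT i0.
have /fineK E1 := integrable_fin_num measurableT iG.
have -> : rho (phi0 - psi) = rho phi0 - rho psi.
  have -> : phi0 - psi = (fun x => 1 * phi0 x + -1 * psi x).
    by apply/funext => x; rewrite mul1r mulN1r.
  by rewrite (dualA_lin rhoA)// mul1r mulN1r.
move: E0 E1; set I0 := fine _; set I1 := fine _ => E0 E1.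
(* The affine function of [l] is the integral of [F l] minus [rho phi0 - l * rho psi]; its values at
   0 and 1 are the two parameters of [affine_le0]. *)
rewrite -E1 lee_fin -subr_le0; apply: (@affine_le0 _ (I0 - rho phi0)) => l l01.
have [il Il] := Fl l l01.
have FlE : (\int[@rV_leb R N]_x F l x = (1 - l)%:E * I0%:E + l%:E * I1%:E)%E.
  rewrite E0 E1 -!integralZl// -integralD//; try exact: integrableZl.
  apply: ae_eq_integral => //.
  - by have /measurable_int := il.
  - by apply: emeasurable_funD; apply: measurable_funeM => //; have /measurable_int := i0.
  - apply: filterS a_lt1 => x /lagr_b_fin [b bE] _.
    by rewrite GE /F -/(a x) bE -!EFinM -EFinD; congr EFin; ring.
move: Il; rewrite FlE -!EFinM -EFinD lee_fin; lra.
Qed.
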